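(* Let $\mathcal{S}$ be the class of Świątkowski functions. Then (i) $\mathcal{B}_1(\mathcal{S})=\mathfrak{S}$; (ii) $\mathcal{B}_\alpha(\mathcal{S})$ equals the class of all functions $\mathbb{R}\to\mathbb{R}$ with the Baire property for every ordinal $1<\alpha<\omega_1$. Hence the Baire order of $\mathcal{S}$ equals $2$.
   Context: $\mathrm{C}(f)$ denotes the set of continuity points of $f$. $f$ is a Świątkowski function if for all $a<b$ with $f(a)\ne f(b)$ there is $x\in(a,b)\cap\mathrm{C}(f)$ with $f(x)$ strictly between $f(a)$ and $f(b)$. For a family $\mathcal{F}$ of functions $\mathbb{R}\to\mathbb{R}$, $\mathrm{LIM}(\mathcal{F})$ is the family of pointwise limits of sequences from $\mathcal{F}$; $\mathcal{B}_0(\mathcal{F})=\mathcal{F}$ and $\mathcal{B}_\alpha(\mathcal{F})=\mathrm{LIM}(\bigcup_{\beta<\alpha}\mathcal{B}_\beta(\mathcal{F}))$ for $\alpha>0$; the Baire order of $\mathcal{F}$ is the least $\alpha\le\omega_1$ with $\mathcal{B}_\alpha(\mathcal{F})=\bigcup_{\beta<\alpha}\mathcal{B}_\beta(\mathcal{F})$. A function has the Baire property if preimages of open sets are of the form $O\triangle M$ with $O$ open and $M$ meager; a set is residual if its complement is meager. For $a,b\in\mathbb{R}$, $I(a,b)$ is the open interval with end-points $a,b$. For $A\subset\mathbb{R}$, an interval $J$ and $\varepsilon\ge0$, $f$ satisfies $S(J,A,\varepsilon)$ if for all $a,b\in J$ with $f(a)<f(b)$ there exists $x\in A\cap I(a,b)$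 with $f(x)\in(f(a)-\varepsilon,f(b)+\varepsilon)$. $f$ satisfies $S(A,\varepsilon)$ if the union of all open intervals $J$ for which $S(J,A,\varepsilon)$ holds is dense in $\mathbb{R}$. $\mathfrak{S}$ is the class of functions with the Baire property satisfying $S(A,\varepsilon)$ for all residual $A$ and all $\varepsilon>0$.
   Formalization: With the Baire order defined as the least α with B_α = ⋃_{β<α} B_β, the order would be 3, since B_1 ≠ B_2 = B_3; ''Baire order 2'' is therefore stated as the hierarchy first stabilizing at 2: B_0 ≠ B_1, B_1 ≠ B_2, B_2 = B_3. *)

(* Defs.v *)
From Stdlib Require Import Reals Lra.
Open Scope R_scope.

Definition fclass := (R -> R) -> Prop.

Definition Swiatkowski (f : R -> R) : Prop :=
  forall a b, a < b -> f a <> f b ->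
    exists x, a < x < b /\ continuity_pt f x /\
      Rmin (f a) (f b) < f x < Rmax (f a) (f b).

Definition LIM (F : fclass) : fclass := fun g =>
  exists fn : nat -> R -> R, (forall n, F (fn n)) /\
    (forall x, Un_cv (fun n => fn n x) (g x)).

(** Baire hierarchy indexed by the elements of a well-ordered type (T, lt):
    BaireW F lt x is B_alpha(F) where alpha is the rank (order type of the
    set of predecessors) of x.  B_0 = F, B_alpha = LIM(U_{beta<alpha} B_beta). *)
Inductive BaireW (F : fclass) {T : Type} (lt : T -> T -> Prop) : T -> fclass :=
| BaireW_zero : forall x g, (forall y, ~ lt y x) -> F g -> BaireW F lt x g
| BaireW_lim : forall x g (fn : nat -> R -> R),
    (forall n, exists y, lt y x /\ BaireW F lt y (fn n)) ->
    (forall t, Un_cv (fun n => fn n t) (g t)) ->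
    BaireW F lt x g.

(** A countable strict well-order: representing a countable ordinal
    (each alpha < omega_1 is the rank of some element of such an order). *)
Definition countable_wellorder (T : Type) (lt : T -> T -> Prop) : Prop :=
  well_founded lt /\
  (forall x y z, lt x y -> lt y z -> lt x z) /\
  (forall x y, lt x y \/ x = y \/ lt y x) /\
  (exists enc : T -> nat, forall a b, enc a = enc b -> a = b).

Definition rank_ge2 {T : Type} (lt : T -> T -> Prop) (x : T) : Prop :=
  exists y1 y2, lt y1 x /\ lt y2 x /\ y1 <> y2.

Definition open_set (U : R -> Prop) : Prop :=
  forall x, U x -> exists eps, 0 < eps /\ forall y, Rabs (y - x) < eps -> U y.

Definition closure (A : R -> Prop) (x : R) : Prop :=
  forall eps, 0 < eps -> exists y, A y /\ Rabs (y - x) < eps.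

Definition nowhere_dense (A : R -> Prop) : Prop :=
  forall U, open_set U -> (forall x, U x -> closure A x) -> forall x, ~ U x.

Definition meager (M : R -> Prop) : Prop :=
  exists An : nat -> R -> Prop, (forall n, nowhere_dense (An n)) /\
    (forall x, M x -> exists n, An n x).

Definition residual (A : R -> Prop) : Prop := meager (fun x => ~ A x).

Definition baire_property (f : R -> R) : Prop :=
  forall V, open_set V -> exists O M, open_set O /\ meager M /\
    forall x, V (f x) <-> ~ (O x <-> M x).

Definition Iab (a b x : R) : Prop := Rmin a b < x < Rmax a b.

Definition S_J (f : R -> R) (c d : R) (A : R -> Prop) (eps : R) : Prop :=
  forall a b, c < a < d -> c < b < d -> f a < f b ->
    exists x, A x /\ Iab a b x /\ f a - eps < f x < f b + eps.

Definition S_A (f : R -> R) (A : R -> Prop) (eps : R) : Prop :=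
  forall u v, u < v -> exists x c d, u < x < v /\ c < x < d /\ S_J f c d A eps.

Definition frakS (f : R -> R) : Prop :=
  baire_property f /\
  forall A, residual A -> forall eps, 0 < eps -> S_A f A eps.

Definition same_class (F G : fclass) : Prop := forall g, F g <-> G g.

(* Main.v *)
(** A function has the Baire property iff its restriction to some residual set C is
    continuous.  If f is a pointwise limit of Świątkowski functions fn, then by the Baire
    category theorem fn is uniformly close to f on C, locally and for large n, and the
    Świątkowski property of fn passes to f up to eps; so f is in frakS.

    Conversely, f in frakS means that densely many intervals J carry a value v with f
    within eps of v on C, and such that f(a) < f(b) in J implies f(a) < v + eps and
    v - eps < f(b).  This gives closed nowhere dense sets F_0 <= F_1 <= ... covering the
    complement of C, where every component of the complement of F_n is such an interval for
    eps = 2^-n.  Let f_n = f on F_n.  On a component I of the complement of F_n let j be least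
    such that I comes within 2^-n of F_j, and let f_n oscillate at both ends of I over the
    band of radius 4 * 2^-(j-1) around the value v of the component of the complement of
    F_(j-1) containing I (over the whole line if j = 0).  Among the components meeting [a, b],
    one of least level j has a band that meets the interval between f_n(a) and f_n(b), since
    [a, b] misses F_(j-1).  A point off all F_n is eventually far from each F_j, whence
    convergence.

    A function with the Baire property is a limit of functions in frakS: keep f on C and on
    the first n nowhere dense sets covering the complement of C, and elsewhere use values of
    f at nearby points of C. *)

Require Import Defs.
From Stdlib Require Import Reals Arith.
From Stdlib Require Import Lra Lia ZArith Classical ClassicalEpsilon Cantor.
(* The real numbers library has its own open_set. *)
Import Defs.
Open Scope R_scope.

(** * Choice, least elements and continuity at a point *)

Lemma choice_fun {A B : Type} (Q : A -> B -> Prop) :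
  (forall x, exists y, Q x y) -> exists h : A -> B, forall x, Q x (h x).
Proof.
  intros H.
  exists (fun x => proj1_sig (constructive_indefinite_description _ (H x))).
  intros x. apply proj2_sig.
Qed.

Lemma least_nat (Q : nat -> Prop) :
  (exists n, Q n) -> exists n, Q n /\ forall m, Q m -> (n <= m)%nat.
Proof.
  intros H.
  destruct (dec_inh_nat_subset_has_unique_least_element Q (fun n => classic (Q n)) H)
    as [n [[H1 H2] _]].
  exists n. split; assumption.
Qed.

Lemma continuity_pt_iff (f : R -> R) (x : R) :
  continuity_pt f x <->
  forall eps, 0 < eps -> exists del, 0 < del /\
    forall y, Rabs (y - x) < del -> Rabs (f y - f x) < eps.
Proof.
  split.
  - intros H eps He. destruct (H eps He) as [del [Hd H']].
    exists del. split; [exact Hd|]. intros y Hy.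
    destruct (Req_dec x y) as [->|Hn].
    + unfold Rminus. rewrite Rplus_opp_r, Rabs_R0. exact He.
    + apply (H' y). split; [split; [exact I|exact Hn]|exact Hy].
  - intros H eps He. destruct (H eps He) as [del [Hd H']].
    exists del. split; [exact Hd|]. intros y [_ Hy]. apply H', Hy.
Qed.

(** * Meager and residual sets *)

Lemma open_interval (u v : R) : open_set (fun x => u < x < v).
Proof.
  intros x Hx. exists (Rmin (x - u) (v - x)). split.
  - apply Rmin_glb_lt; lra.
  - intros y Hy. apply Rabs_def2 in Hy.
    pose proof (Rmin_l (x - u) (v - x)). pose proof (Rmin_r (x - u) (v - x)). lra.
Qed.

(** If every point of (u, v) were in the closure, the open interval itself would contradict nowhere
    density. Closed subintervals are produced because the category argument nests them. *)
Lemma nowhere_dense_avoid (A : R -> Prop) (u v : R) :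
  nowhere_dense A -> u < v ->
  exists c d, u < c /\ c < d /\ d < v /\ forall x, c <= x <= d -> ~ A x.
Proof.
  intros HA Huv.
  destruct (classic (exists x, u < x < v /\ ~ closure A x)) as [[x [Hx Hc]]|H].
  - apply not_all_ex_not in Hc. destruct Hc as [eps Hc].
    apply imply_to_and in Hc. destruct Hc as [He Hc].
    set (m := Rmin eps (Rmin (x - u) (v - x))).
    assert (Hm : 0 < m) by (repeat apply Rmin_glb_lt; lra).
    assert (m <= eps) by apply Rmin_l.
    assert (m <= x - u) by (eapply Rle_trans; [apply Rmin_r|apply Rmin_l]).
    assert (m <= v - x) by (eapply Rle_trans; [apply Rmin_r|apply Rmin_r]).
    exists (x - m / 2), (x + m / 2). repeat split; try lra.
    intros y Hy Ay. apply Hc. exists y. split; [exact Ay|].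
    apply Rabs_def1; lra.
  - exfalso. apply (HA _ (open_interval u v)) with (x := (u + v) / 2); [|lra].
    intros x Hx. apply NNPP. intros Hn. apply H. exists x. split; assumption.
Qed.

Lemma nowhere_dense_intro (A : R -> Prop) :
  (forall u v, u < v -> exists c d, u <= c /\ c < d /\ d <= v /\
     forall x, c < x < d -> ~ A x) -> nowhere_dense A.
Proof.
  intros H U HU Hcl x Ux.
  destruct (HU x Ux) as [eps [He Hb]].
  destruct (H (x - eps) (x + eps)) as [c [d [H1 [H2 [H3 H4]]]]]; [lra|].
  assert (Um : U ((c + d) / 2)) by (apply Hb, Rabs_def1; lra).
  destruct (Hcl _ Um ((d - c) / 2)) as [y [Ay Hy]]; [lra|].
  apply Rabs_def2 in Hy. apply (H4 y); [lra|exact Ay].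
Qed.

Lemma nowhere_dense_avoid_upto (A : nat -> R -> Prop) (n : nat) (u v : R) :
  (forall i, nowhere_dense (A i)) -> u < v ->
  exists c d, u < c /\ c < d /\ d < v /\
    forall i, (i <= n)%nat -> forall x, c <= x <= d -> ~ A i x.
Proof.
  intros HA. revert u v. induction n as [|n IH]; intros u v Huv.
  - destruct (nowhere_dense_avoid (A O) u v (HA O) Huv) as [c [d H]].
    exists c, d. intuition. assert (i = O) by lia. subst. firstorder.
  - destruct (IH u v Huv) as [c [d [H1 [H2 [H3 H4]]]]].
    destruct (nowhere_dense_avoid (A (S n)) c d (HA _) H2) as [c' [d' [K1 [K2 [K3 K4]]]]].
    exists c', d'. repeat split; try lra.
    intros i Hi x Hx. destruct (Nat.eq_dec i (S n)) as [->|Hn].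
    + apply K4; lra.
    + apply H4; [lia|lra].
Qed.

Lemma not_nowhere_dense (A : R -> Prop) :
  ~ nowhere_dense A ->
  exists c d, c < d /\ forall x, c < x < d -> closure A x.
Proof.
  intros H. apply NNPP. intros Hn. apply H. apply nowhere_dense_intro.
  intros u v Huv. apply NNPP. intros Hm. apply Hn. exists u, v. split; [exact Huv|].
  intros x Hx eps He. apply NNPP. intros Hy. apply Hm.
  exists (Rmax u (x - eps)), (Rmin v (x + eps)). split; [apply Rmax_l|].
  split; [apply Rmax_lub_lt; apply Rmin_glb_lt; lra|]. split; [apply Rmin_l|].
  intros y [Hy1 Hy2] Ay. apply Hy. exists y. split; [exact Ay|].
  pose proof (Rmax_r u (x - eps)). pose proof (Rmin_r v (x + eps)).
  apply Rabs_def1; lra.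
Qed.

Theorem baire_category (M : R -> Prop) (u v : R) :
  meager M -> u < v -> exists x, u < x < v /\ ~ M x.
Proof.
  intros [A [HA HM]] Huv.
  (* The premise makes the relation total: for pairs that are not intervals, (0, 0) is a dummy
     value. *)
  destruct (choice_fun (fun (q : nat * (R * R)) (r : R * R) =>
    fst (snd q) < snd (snd q) ->
    fst (snd q) < fst r /\ fst r < snd r /\ snd r < snd (snd q) /\
    forall x, fst r <= x <= snd r -> ~ A (fst q) x)) as [step Hstep].
  { intros [n [a b]]; simpl. destruct (Rlt_dec a b) as [Hab|Hab].
    - destruct (nowhere_dense_avoid (A n) a b (HA n) Hab) as [c [d H]].
      exists (c, d). intros _. exact H.
    - exists (0, 0). intros; contradiction. }
  set (I := fix I n := match n with O => (u, v) | S k => step (k, I k) end).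
  assert (HI : forall n, fst (I n) < snd (I n)).
  { induction n as [|n IH]; [exact Huv|]. simpl. apply (Hstep (n, I n) IH). }
  assert (Hs : forall n, fst (I n) < fst (I (S n)) /\ snd (I (S n)) < snd (I n) /\
    forall x, fst (I (S n)) <= x <= snd (I (S n)) -> ~ A n x).
  { intros n. destruct (Hstep (n, I n) (HI n)) as [H1 [H2 [H3 H4]]].
    repeat split; assumption. }
  assert (Hinc : forall n k, fst (I n) <= fst (I (k + n)%nat)).
  { intros n k; induction k as [|k IH]; [apply Rle_refl|].
    change (S k + n)%nat with (S (k + n)). destruct (Hs (k + n)%nat). lra. }
  assert (Hdec : forall n k, snd (I (k + n)%nat) <= snd (I n)).
  { intros n k; induction k as [|k IH]; [apply Rle_refl|].
    change (S k + n)%nat with (S (k + n)). destruct (Hs (k + n)%nat) as [_ [? _]]. lra. }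
  assert (Hlr : forall n m, fst (I n) <= snd (I m)).
  { intros n m. pose proof (Hinc n m). pose proof (Hdec m n).
    rewrite Nat.add_comm in H0. pose proof (HI (m + n)%nat). lra. }
  (* The supremum of the left ends lies in all the nested closed intervals. *)
  destruct (completeness (fun y => exists n, y = fst (I n))) as [x [Hub Hlub]].
  { exists v. intros y [n ->]. exact (Hlr n O). }
  { exists u, O. reflexivity. }
  assert (Hx : forall n, fst (I n) <= x <= snd (I n)).
  { intros n. split; [apply Hub; exists n; reflexivity|].
    apply Hlub. intros y [m ->]. apply Hlr. }
  exists x. split.
  - pose proof (Hx 1%nat). destruct (Hs O) as [H1 [H2 _]].
    change (fst (I O)) with u in H1. change (snd (I O)) with v in H2. lra.
  - intros Mx. destruct (HM x Mx) as [n An].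
    destruct (Hs n) as [_ [_ H]]. apply (H x (Hx (S n)) An).
Qed.

Lemma meager_subset (M N : R -> Prop) :
  meager N -> (forall x, M x -> N x) -> meager M.
Proof. intros [A [H1 H2]] H. exists A. split; [exact H1|]. auto. Qed.

Lemma meager_union (M : nat -> R -> Prop) :
  (forall n, meager (M n)) -> meager (fun x => exists n, M n x).
Proof.
  intros H. destruct (choice_fun _ H) as [A HA].
  exists (fun k => A (fst (Cantor.of_nat k)) (snd (Cantor.of_nat k))). split.
  - intros k. apply HA.
  - intros x [n Mx]. destruct (proj2 (HA n) x Mx) as [m Am].
    exists (Cantor.to_nat (n, m)). rewrite Cantor.cancel_of_to. exact Am.
Qed.

Lemma meager_union_Z (M : Z -> R -> Prop) :
  (forall k, meager (M k)) -> meager (fun x => exists k, M k x).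
Proof.
  intros H. apply meager_subset with
    (fun x => exists a, exists b, M (Z.of_nat a - Z.of_nat b)%Z x).
  - apply meager_union; intros a. apply meager_union; intros b. apply H.
  - intros x [k Mk]. exists (Z.to_nat k), (Z.to_nat (- k)).
    replace (Z.of_nat (Z.to_nat k) - Z.of_nat (Z.to_nat (- k)))%Z with k by lia.
    exact Mk.
Qed.

Lemma nowhere_dense_meager (A : R -> Prop) : nowhere_dense A -> meager A.
Proof. intros H. exists (fun _ => A). split; [auto|]. intros x Ax. exists O. exact Ax. Qed.

Lemma residual_inter (A B : R -> Prop) :
  residual A -> residual B -> residual (fun x => A x /\ B x).
Proof.
  intros HA HB.
  apply meager_subset with (fun x => exists n, match n with O => ~ A x | S _ => ~ B x end).
  - apply meager_union. intros [|n]; assumption.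
  - intros x H. apply not_and_or in H. destruct H; [exists O|exists 1%nat]; assumption.
Qed.

Lemma residual_inter_nat (A : nat -> R -> Prop) :
  (forall n, residual (A n)) -> residual (fun x => forall n, A n x).
Proof.
  intros H. apply meager_subset with (fun x => exists n, ~ A n x).
  - apply meager_union, H.
  - intros x Hx. apply not_all_ex_not, Hx.
Qed.

Lemma residual_dense (A : R -> Prop) (u v : R) :
  residual A -> u < v -> exists x, u < x < v /\ A x.
Proof.
  intros H Huv. destruct (baire_category _ u v H Huv) as [x [H1 H2]].
  exists x. split; [exact H1|]. apply NNPP, H2.
Qed.

(** * Continuity on residual sets *)

Definition cont_on (C : R -> Prop) (f : R -> R) : Prop :=
  forall x, C x -> forall eps, 0 < eps -> exists del, 0 < del /\
    forall y, C y -> Rabs (y - x) < del -> Rabs (f y - f x) < eps.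

Definition generic_cont (f : R -> R) : Prop :=
  exists C, residual C /\ cont_on C f.

Lemma cont_on_subset (C D : R -> Prop) (f : R -> R) :
  (forall x, D x -> C x) -> cont_on C f -> cont_on D f.
Proof.
  intros H HC x Dx eps He. destruct (HC x (H x Dx) eps He) as [del [Hd H']].
  exists del. split; auto.
Qed.

Lemma inv_pow2_pos (n : nat) : 0 < / 2 ^ n.
Proof. apply Rinv_0_lt_compat, pow_lt; lra. Qed.

Lemma inv_pow2_small (e : R) : 0 < e -> exists n, / 2 ^ n < e.
Proof.
  intros He. destruct (pow_lt_1_zero (/ 2)) with (y := e) as [N HN].
  - rewrite Rabs_right; lra.
  - exact He.
  - exists N. specialize (HN N (le_n N)).
    rewrite pow_inv in HN. rewrite Rabs_right in HN; [exact HN|].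
    apply Rle_ge, Rlt_le, inv_pow2_pos.
Qed.

Lemma inv_pow2_le (m n : nat) : (m <= n)%nat -> / 2 ^ n <= / 2 ^ m.
Proof.
  intros H. apply Rinv_le_contravar; [apply pow_lt; lra|].
  apply Rle_pow; [lra|exact H].
Qed.

Lemma inv_pow2_S (n : nat) : / 2 ^ (S n) = / 2 ^ n / 2.
Proof. simpl. field. apply pow_nonzero; lra. Qed.

Lemma dyadic_left (x : R) (m : nat) :
  exists k : Z, IZR k / 2 ^ m <= x < (IZR k + 1) / 2 ^ m.
Proof.
  assert (Hp : 0 < 2 ^ m) by (apply pow_lt; lra).
  exists (Int_part (x * 2 ^ m)). destruct (base_Int_part (x * 2 ^ m)) as [H1 H2].
  split.
  - apply Rmult_le_reg_r with (2 ^ m); [exact Hp|].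
    unfold Rdiv. rewrite Rmult_assoc, Rinv_l, Rmult_1_r; lra.
  - apply Rmult_lt_reg_r with (2 ^ m); [exact Hp|].
    unfold Rdiv. rewrite Rmult_assoc, Rinv_l, Rmult_1_r; lra.
Qed.

(** Discard the meager parts of the preimages of all intervals with centre k/2^m and radius 1/2^m.
    On what remains these preimages are relatively open. The intervals overlap, so every value lies
    strictly inside one of each generation m. *)
Lemma baire_property_generic_cont (f : R -> R) :
  baire_property f -> generic_cont f.
Proof.
  intros H.
  destruct (choice_fun (fun (q : nat * Z) (r : (R -> Prop) * (R -> Prop)) =>
    open_set (fst r) /\ meager (snd r) /\
    forall x, (IZR (snd q) - 1) / 2 ^ fst q < f x < (IZR (snd q) + 1) / 2 ^ fst q <->
              ~ (fst r x <-> snd r x))) as [h Hh].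
  { intros [m k]; simpl. destruct (H _ (open_interval ((IZR k - 1) / 2 ^ m) ((IZR k + 1) / 2 ^ m)))
      as [O [M HOM]]. exists (O, M). exact HOM. }
  exists (fun x => ~ exists m, exists k, snd (h (m, k)) x). split.
  - apply meager_subset with (fun x => exists m, exists k, snd (h (m, k)) x).
    + apply meager_union; intros m. apply meager_union_Z; intros k. apply (Hh (m, k)).
    + intros x Hx. apply NNPP, Hx.
  (* The interval around f x has length 2/2^m, which is below eps. *)
  - intros x Cx eps He. destruct (inv_pow2_small (eps / 2)) as [m Hm]; [lra|].
    destruct (dyadic_left (f x) m) as [k [Hk1 Hk2]].
    pose proof (inv_pow2_pos m) as Hp.
    destruct (Hh (m, k)) as [Hop [_ Hfx]]; simpl in Hop, Hfx.
    unfold Rdiv in *.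
    assert (Hnbh : forall y, ~ (exists m k, snd (h (m, k)) y) ->
      (fst (h (m, k)) y <-> (IZR k - 1) * / 2 ^ m < f y < (IZR k + 1) * / 2 ^ m)).
    { intros y Cy. rewrite Hfx.
      assert (~ snd (h (m, k)) y) by (intros Hy; apply Cy; exists m, k; exact Hy).
      tauto. }
    destruct (Hop x) as [del [Hd Hd']].
    { apply Hnbh; [exact Cx|]. lra. }
    exists del. split; [exact Hd|]. intros y Cy Hy.
    apply Hd', (Hnbh y Cy) in Hy. apply Rabs_def1; lra.
Qed.

(** The open set consists of the points near which f maps C into V. By continuity on C it agrees
    with the preimage of V at every point of C, so the difference lies in the meager complement. *)
Lemma generic_cont_baire_property (f : R -> R) :
  generic_cont f -> baire_property f.
Proof.
  intros [C [HC Hf]] V HV.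
  set (O := fun x => exists e, 0 < e /\ forall y, C y -> Rabs (y - x) < e -> V (f y)).
  exists O, (fun x => ~ (O x <-> V (f x))). split; [|split].
  - intros x [e [He H]]. exists (e / 2). split; [lra|].
    intros y Hy. exists (e / 2). split; [lra|]. intros z Cz Hz.
    apply H; [exact Cz|]. apply Rabs_def2 in Hy, Hz. apply Rabs_def1; lra.
  - apply meager_subset with (fun x => ~ C x); [exact HC|].
    intros x Hx Cx. apply Hx. split.
    + intros [e [He H]]. apply H; [exact Cx|].
      unfold Rminus. rewrite Rplus_opp_r, Rabs_R0. exact He.
    + intros Vx. destruct (HV _ Vx) as [eps [He HV']].
      destruct (Hf x Cx eps He) as [del [Hd Hd']].
      exists del. split; [exact Hd|]. intros y Cy Hy. apply HV', Hd'; assumption.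
  - intros x. tauto.
Qed.

(** For each n, the points having no neighbourhood where f|C oscillates by less than 2^-n form a
    nowhere dense set. This upgrades a dense supply of good intervals to a residual set of good
    points. *)
Lemma small_oscillation_residual (C : R -> Prop) (f : R -> R) :
  (forall u v eps, u < v -> 0 < eps -> exists c d, u <= c /\ c < d /\ d <= v /\
     forall y z, c < y < d -> c < z < d -> C y -> C z -> Rabs (f y - f z) < eps) ->
  residual (fun x => forall eps, 0 < eps -> exists del, 0 < del /\
     forall y z, C y -> C z -> Rabs (y - x) < del -> Rabs (z - x) < del ->
       Rabs (f y - f z) < eps).
Proof.
  intros H.
  apply meager_subset with (fun x => exists n, ~ exists c d, c < x < d /\
    forall y z, c < y < d -> c < z < d -> C y -> C z -> Rabs (f y - f z) < / 2 ^ n).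
  - apply meager_union. intros n. apply nowhere_dense_meager, nowhere_dense_intro.
    intros u v Huv.
    destruct (H u v (/ 2 ^ n) Huv (inv_pow2_pos n)) as [c [d [H1 [H2 [H3 H4]]]]].
    exists c, d. repeat split; try assumption. intros x Hx Hn. apply Hn.
    exists c, d. split; assumption.
  - intros x Hx. apply NNPP. intros Hn. apply Hx. intros eps He.
    destruct (inv_pow2_small eps He) as [n Hsm].
    destruct (classic (exists c d, c < x < d /\ forall y z, c < y < d -> c < z < d ->
      C y -> C z -> Rabs (f y - f z) < / 2 ^ n)) as [[c [d [Hcd H']]]|Hm].
    + exists (Rmin (x - c) (d - x)). split; [apply Rmin_glb_lt; lra|].
      pose proof (Rmin_l (x - c) (d - x)). pose proof (Rmin_r (x - c) (d - x)).
      intros y z Cy Cz Hy Hz. apply Rabs_def2 in Hy, Hz.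
      apply Rlt_trans with (/ 2 ^ n); [|exact Hsm]. apply H'; try assumption; lra.
    + exfalso. apply Hn. exists n. exact Hm.
Qed.

(* The Baire category theorem applied to the sets where |fn n - fn N| <= eps/8 for all n >= N. *)
Lemma pointwise_limit_locally_uniform (C : R -> Prop) (fn : nat -> R -> R) (f : R -> R)
    (u v eps : R) :
  residual C -> (forall n, cont_on C (fn n)) ->
  (forall x, Un_cv (fun n => fn n x) (f x)) -> u < v -> 0 < eps ->
  exists N c d, u <= c /\ c < d /\ d <= v /\
    forall x n, C x -> c < x < d -> (N <= n)%nat -> Rabs (fn n x - f x) < eps.
Proof.
  intros HC Hfn Hcv Huv He.
  set (E := fun N x => u < x < v /\ C x /\
    forall n, (N <= n)%nat -> Rabs (fn n x - fn N x) <= eps / 8).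
  assert (HE : exists N, ~ nowhere_dense (E N)).
  { apply NNPP. intros Hn.
    assert (HM : meager (fun x => exists N, E N x)).
    { apply meager_union. intros N. apply nowhere_dense_meager, NNPP.
      intros Hm. apply Hn. exists N. exact Hm. }
    assert (HR : residual (fun x => C x /\ ~ exists N, E N x)).
    { apply residual_inter; [exact HC|]. unfold residual.
      apply meager_subset with (1 := HM). intros x Hx. apply NNPP, Hx. }
    destruct (residual_dense _ u v HR Huv) as [x [Hx [Cx Hm]]].
    apply Hm. destruct (Hcv x (eps / 16)) as [N HN]; [lra|].
    exists N. split; [exact Hx|]. split; [exact Cx|]. intros n Hnn.
    pose proof (HN n Hnn) as H1. pose proof (HN N (le_n N)) as H2.
    unfold Rdist in *. apply Rabs_def2 in H1, H2. apply Rabs_le. lra. }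
  destruct HE as [N HN]. destruct (not_nowhere_dense _ HN) as [c0 [d0 [Hcd0 Hcl]]].
  (* A point of [E N] inside (c0, d0) shows that this interval overlaps (u, v). *)
  destruct (Hcl ((c0 + d0) / 2)) with (eps := (d0 - c0) / 2) as [y0 [[Hy0 _] Hy0']]; [lra|lra|].
  apply Rabs_def2 in Hy0'.
  exists N, (Rmax u c0), (Rmin v d0). split; [apply Rmax_l|].
  split; [apply Rmax_lub_lt; apply Rmin_glb_lt; lra|]. split; [apply Rmin_l|].
  (* Continuity on C of [fn n] and [fn N] carries the bound from the dense set [E N] to all of C, at
     the cost of eps/8 for each function. *)
  assert (H3 : forall x n, C x -> Rmax u c0 < x < Rmin v d0 -> (N <= n)%nat ->
    Rabs (fn n x - fn N x) < 3 * eps / 8).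
  { intros x n Cx Hx Hn.
    destruct (Hfn n x Cx (eps / 8)) as [e1 [He1 H1]]; [lra|].
    destruct (Hfn N x Cx (eps / 8)) as [e2 [He2 H2]]; [lra|].
    pose proof (Rmax_r u c0). pose proof (Rmin_r v d0).
    destruct (Hcl x) with (eps := Rmin e1 e2) as [y [[_ [Cy Hy]] Hyx]];
      [lra|apply Rmin_glb_lt; lra|].
    pose proof (Rmin_l e1 e2). pose proof (Rmin_r e1 e2).
    specialize (H1 y Cy ltac:(lra)). specialize (H2 y Cy ltac:(lra)).
    specialize (Hy n Hn).
    apply Rabs_def2 in H1, H2.
    assert (Hy1 := Rle_abs (fn n y - fn N y)).
    assert (Hy2 := Rle_abs (- (fn n y - fn N y))). rewrite Rabs_Ropp in Hy2.
    apply Rabs_def1; lra. }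
  (* Compare through a late index: 3/8 + 3/8 + 1/8 of eps in total. *)
  intros x n Cx Hx Hn. destruct (Hcv x (eps / 8)) as [K HK]; [lra|].
  specialize (HK (Nat.max K N) (Nat.le_max_l _ _)). unfold Rdist in HK.
  pose proof (H3 x n Cx Hx Hn) as H4.
  pose proof (H3 x (Nat.max K N) Cx Hx (Nat.le_max_r _ _)) as H5.
  apply Rabs_def2 in HK, H4, H5.
  apply Rabs_def1; lra.
Qed.

(** Locally f|C is uniformly close to one [fn N], which is itself continuous on C. So f|C has small
    oscillation on densely many intervals, hence at residually many points. *)
Lemma generic_cont_limit (fn : nat -> R -> R) (f : R -> R) :
  (forall n, generic_cont (fn n)) -> (forall x, Un_cv (fun n => fn n x) (f x)) ->
  generic_cont f.
Proof.
  intros Hg Hcv. destruct (choice_fun _ Hg) as [D HD].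
  set (C := fun x => forall n, D n x).
  assert (HC : residual C) by (apply residual_inter_nat; intros n; apply HD).
  assert (Hc : forall n, cont_on C (fn n)).
  { intros n. apply cont_on_subset with (D n); [intros x Hx; apply Hx|apply HD]. }
  assert (Hosc : residual (fun x => forall eps, 0 < eps -> exists del, 0 < del /\
     forall y z, C y -> C z -> Rabs (y - x) < del -> Rabs (z - x) < del ->
       Rabs (f y - f z) < eps)).
  { apply small_oscillation_residual. intros u v eps Huv He.
    destruct (pointwise_limit_locally_uniform C fn f u v (eps / 4) HC Hc Hcv Huv)
      as [N [c [d [H1 [H2 [H3 H4]]]]]]; [lra|].
    destruct (residual_dense C c d HC H2) as [x [Hx Cx]].
    destruct (Hc N x Cx (eps / 4)) as [del [Hd H5]]; [lra|].
    pose proof (Rmax_l c (x - del)). pose proof (Rmax_r c (x - del)).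
    pose proof (Rmin_l d (x + del)). pose proof (Rmin_r d (x + del)).
    exists (Rmax c (x - del)), (Rmin d (x + del)).
    split; [lra|]. split; [apply Rmax_lub_lt; apply Rmin_glb_lt; lra|]. split; [lra|].
    intros y z Hy Hz Cy Cz.
    assert (Gy := H5 y Cy ltac:(apply Rabs_def1; lra)).
    assert (Gz := H5 z Cz ltac:(apply Rabs_def1; lra)).
    assert (Ky := H4 y N Cy ltac:(lra) (le_n N)).
    assert (Kz := H4 z N Cz ltac:(lra) (le_n N)).
    apply Rabs_def2 in Gy, Gz, Ky, Kz. apply Rabs_def1; lra. }
  eexists. split; [exact (residual_inter _ _ HC Hosc)|].
  intros x [Cx Ox] eps He. destruct (Ox eps He) as [del [Hd H]].
  exists del. split; [exact Hd|]. intros y [Cy _] Hy.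
  apply H; try assumption. unfold Rminus. rewrite Rplus_opp_r, Rabs_R0. exact Hd.
Qed.

(** * Świątkowski functions and their limits *)

Lemma Swiatkowski_residual_continuity (f : R -> R) :
  Swiatkowski f -> residual (continuity_pt f).
Proof.
  intros HS.
  (* Continuity points are dense: on an interval where f is not constant the Świątkowski property
     supplies one, and on the others every point is one. *)
  assert (Hd : forall u v, u < v -> exists x, u < x < v /\ continuity_pt f x).
  { intros u v Huv.
    destruct (classic (exists a b, u < a /\ a < b /\ b < v /\ f a <> f b))
      as [[a [b [H1 [H2 [H3 H4]]]]]|H].
    - destruct (HS a b H2 H4) as [x [Hx [Hc _]]]. exists x. split; [lra|exact Hc].
    - assert (Hk : forall a b, u < a < v -> u < b < v -> f a = f b).
      { intros a b Ha Hb. apply NNPP. intros Hn. apply H.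
        destruct (Rtotal_order a b) as [?|[->|?]].
        - exists a, b. split; [lra|]. split; [lra|]. split; [lra|exact Hn].
        - contradiction.
        - exists b, a. split; [lra|]. split; [lra|]. split; [lra|auto]. }
      exists ((u + v) / 2). split; [lra|]. apply continuity_pt_iff. intros eps He.
      exists ((v - u) / 2). split; [lra|]. intros y Hy. apply Rabs_def2 in Hy.
      rewrite (Hk y ((u + v) / 2)) by lra.
      unfold Rminus. rewrite Rplus_opp_r, Rabs_R0. exact He. }
  eapply meager_subset.
  (* With the whole line in place of C, small oscillation at a point is ordinary continuity
     there. *)
  - apply (small_oscillation_residual (fun _ => True) f). intros u v eps Huv He.
    destruct (Hd u v Huv) as [x [Hx Hc]].
    destruct (proj1 (continuity_pt_iff f x) Hc (eps / 2)) as [del [Hdel H]]; [lra|].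
    pose proof (Rmax_l u (x - del)). pose proof (Rmax_r u (x - del)).
    pose proof (Rmin_l v (x + del)). pose proof (Rmin_r v (x + del)).
    exists (Rmax u (x - del)), (Rmin v (x + del)).
    split; [lra|]. split; [apply Rmax_lub_lt; apply Rmin_glb_lt; lra|]. split; [lra|].
    intros y z Hy Hz _ _.
    assert (Gy := H y ltac:(apply Rabs_def1; lra)).
    assert (Gz := H z ltac:(apply Rabs_def1; lra)).
    apply Rabs_def2 in Gy, Gz. apply Rabs_def1; lra.
  - intros x Hx Ho. apply Hx, continuity_pt_iff. intros eps He.
    destruct (Ho eps He) as [del [Hdel H]]. exists del. split; [exact Hdel|].
    intros y Hy. apply H; auto. unfold Rminus. rewrite Rplus_opp_r, Rabs_R0. exact Hdel.
Qed.

Lemma continuity_pt_cont_on (f : R -> R) : cont_on (continuity_pt f) f.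
Proof.
  intros x Cx eps He. destruct (proj1 (continuity_pt_iff f x) Cx eps He) as [del [Hd H]].
  exists del. split; auto.
Qed.

Lemma Swiatkowski_baire_property (f : R -> R) : Swiatkowski f -> baire_property f.
Proof.
  intros H. apply generic_cont_baire_property. exists (continuity_pt f). split.
  - apply Swiatkowski_residual_continuity, H.
  - apply continuity_pt_cont_on.
Qed.

Lemma baire_property_limit (F : fclass) (g : R -> R) :
  (forall f, F f -> baire_property f) -> LIM F g -> baire_property g.
Proof.
  intros HF [fn [H1 H2]]. apply generic_cont_baire_property, generic_cont_limit with fn.
  - intros n. apply baire_property_generic_cont, HF, H1.
  - exact H2.
Qed.

Lemma LIM_Swiatkowski_frakS (g : R -> R) : LIM Swiatkowski g -> frakS g.
Proof.
  intros Hg. split.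
  { apply baire_property_limit with Swiatkowski; [exact Swiatkowski_baire_property|exact Hg]. }
  destruct Hg as [fn [HS Hcv]]. intros A HA eps He u v Huv.
  set (C := fun x => forall n, continuity_pt (fn n) x).
  assert (HC : residual C).
  { apply residual_inter_nat. intros n. apply Swiatkowski_residual_continuity, HS. }
  assert (Hc : forall n, cont_on C (fn n)).
  { intros n. apply cont_on_subset with (continuity_pt (fn n)); [intros x Hx; apply Hx|].
    apply continuity_pt_cont_on. }
  destruct (pointwise_limit_locally_uniform C fn g u v (eps / 2) HC Hc Hcv Huv)
    as [N [c [d [H1 [H2 [H3 H4]]]]]]; [lra|].
  exists ((c + d) / 2), c, d. split; [lra|]. split; [lra|].
  intros a b Ha Hb Hab.
  (* Half the gap preserves the strict order of the values at a and b under [fn n]; eps/2 is the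
     error allowed at the end points. *)
  set (e := Rmin (eps / 2) ((g b - g a) / 2)).
  assert (He' : 0 < e) by (apply Rmin_glb_lt; lra).
  assert (e <= eps / 2) by apply Rmin_l. assert (e <= (g b - g a) / 2) by apply Rmin_r.
  destruct (Hcv a e He') as [Na HNa]. destruct (Hcv b e He') as [Nb HNb].
  set (n := Nat.max N (Nat.max Na Nb)).
  specialize (HNa n ltac:(lia)). specialize (HNb n ltac:(lia)).
  unfold Rdist in HNa, HNb. apply Rabs_def2 in HNa, HNb.
  assert (Hlt : fn n a < fn n b) by lra.
  assert (Hx : exists x, Iab a b x /\ continuity_pt (fn n) x /\ fn n a < fn n x < fn n b).
  { unfold Iab. destruct (Rtotal_order a b) as [Hl|[->|Hl]]; [|lra|].
    - destruct (HS n a b Hl) as [x [Hx [Hx' Hx'']]]; [lra|].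
      rewrite Rmin_left, Rmax_right in Hx'' by lra.
      exists x. rewrite Rmin_left, Rmax_right by lra. tauto.
    - destruct (HS n b a Hl) as [x [Hx [Hx' Hx'']]]; [lra|].
      rewrite Rmin_right, Rmax_left in Hx'' by lra.
      exists x. rewrite Rmin_right, Rmax_left by lra. tauto. }
  destruct Hx as [x [Hx [Hx' Hx'']]].
  destruct (proj1 (continuity_pt_iff (fn n) x) Hx'
    (Rmin (fn n x - fn n a) (fn n b - fn n x))) as [del [Hdel Hnb]].
  { apply Rmin_glb_lt; lra. }
  unfold Iab in *.
  pose proof (Rmax_l (Rmin a b) (x - del)). pose proof (Rmax_r (Rmin a b) (x - del)).
  pose proof (Rmin_l (Rmax a b) (x + del)). pose proof (Rmin_r (Rmax a b) (x + del)).
  (* The point x need not be in A. By continuity of [fn n] at x, a nearby y in A and C still has its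
     value between [fn n a] and [fn n b]; replacing [fn n] by g at y costs another eps/2. *)
  destruct (residual_dense (fun y => C y /\ A y) (Rmax (Rmin a b) (x - del))
    (Rmin (Rmax a b) (x + del))) as [y [Hy [Cy Ay]]].
  { apply residual_inter; assumption. }
  { apply Rmax_lub_lt; apply Rmin_glb_lt; lra. }
  exists y. split; [exact Ay|]. split; [lra|].
  assert (Hd := Hnb y ltac:(apply Rabs_def1; lra)).
  pose proof (Rmin_l (fn n x - fn n a) (fn n b - fn n x)).
  pose proof (Rmin_r (fn n x - fn n a) (fn n b - fn n x)).
  assert (c < Rmin a b) by (apply Rmin_glb_lt; lra).
  assert (Rmax a b < d) by (apply Rmax_lub_lt; lra).
  assert (Hg := H4 y n Cy ltac:(lra) ltac:(lia)).
  apply Rabs_def2 in Hd, Hg. lra.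
Qed.

(* A point outside C first caught by A m takes a value of f at a nearby point of C;
   the points caught late do not spoil the closeness to f|C, and those caught early
   form a nowhere dense set. *)
Lemma baire_property_LIM_frakS (f : R -> R) : baire_property f -> LIM frakS f.
Proof.
  intros Hf. destruct (baire_property_generic_cont f Hf) as [C [HC Hc]].
  pose proof HC as [A [HA HCA]].
  destruct (choice_fun (fun (q : R * nat) c => C c /\ Rabs (c - fst q) < / 2 ^ snd q))
    as [near Hnear].
  { intros [x m]; simpl. pose proof (inv_pow2_pos m).
    destruct (residual_dense C (x - / 2 ^ m) (x + / 2 ^ m) HC) as [c [H1 H2]]; [lra|].
    exists c. split; [exact H2|]. apply Rabs_def1; lra. }
  destruct (choice_fun (fun x m => ~ C x -> A m x /\ forall i, A i x -> (m <= i)%nat))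
    as [rk Hrk].
  { intros x. destruct (classic (C x)) as [Hx|Hx]; [exists O; tauto|].
    destruct (least_nat (fun m => A m x) (HCA x Hx)) as [m Hm]. exists m. auto. }
  set (fn := fun (n : nat) x =>
    if excluded_middle_informative (C x \/ (rk x <= n)%nat) then f x
    else f (near (x, rk x))).
  assert (HfC : forall n x, C x -> fn n x = f x).
  { intros n x Cx. unfold fn.
    destruct (excluded_middle_informative (C x \/ (rk x <= n)%nat)); tauto. }
  exists fn. split.
  - intros n. split.
    { apply generic_cont_baire_property. exists C. split; [exact HC|].
      intros x Cx eps He. destruct (Hc x Cx eps He) as [del [Hd H]].
      exists del. split; [exact Hd|]. intros y Cy Hy. rewrite !HfC; auto. }
    intros B HB eps He u v Huv.
    destruct (residual_dense C u v HC Huv) as [c0 [Hc0 Cc0]].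
    destruct (Hc c0 Cc0 (eps / 2)) as [del [Hd Hdel]]; [lra|].
    destruct (inv_pow2_small (del / 2)) as [m Hm]; [lra|].
    set (u' := Rmax u (c0 - del / 2)). set (v' := Rmin v (c0 + del / 2)).
    assert (u <= u') by apply Rmax_l. assert (c0 - del / 2 <= u') by apply Rmax_r.
    assert (v' <= v) by apply Rmin_l. assert (v' <= c0 + del / 2) by apply Rmin_r.
    assert (Huv' : u' < v') by (apply Rmax_lub_lt; apply Rmin_glb_lt; lra).
    (* Off C, the points of the new interval have rank above n, so [fn n] uses the nearby value
       there, and above m, so the nearby point is within del/2. *)
    destruct (nowhere_dense_avoid_upto A (Nat.max m n) u' v' HA Huv')
      as [c [d [L1 [L2 [L3 L4]]]]].
    assert (Hclose : forall x, c < x < d -> Rabs (fn n x - f c0) < eps / 2).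
    { intros x Hx. destruct (classic (C x)) as [Cx|Cx].
      - rewrite HfC by exact Cx. apply Hdel; [exact Cx|]. apply Rabs_def1; lra.
      - destruct (Hrk x Cx) as [Hr _].
        assert (Hr' : (Nat.max m n < rk x)%nat).
        { apply Nat.lt_nge. intros Hle. apply (L4 (rk x) Hle x); [lra|exact Hr]. }
        unfold fn. destruct (excluded_middle_informative (C x \/ (rk x <= n)%nat))
          as [[?|?]|_]; [contradiction|lia|].
        destruct (Hnear (x, rk x)) as [K1 K2]; simpl in K2.
        apply Hdel; [exact K1|].
        pose proof (inv_pow2_le m (rk x) ltac:(lia)).
        apply Rabs_def2 in K2. apply Rabs_def1; lra. }
    exists ((c + d) / 2), c, d. split; [lra|]. split; [lra|].
    intros a b Ha Hb Hab.
    assert (c < Rmin a b) by (apply Rmin_glb_lt; lra).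
    assert (Rmax a b < d) by (apply Rmax_lub_lt; lra).
    destruct (residual_dense B (Rmin a b) (Rmax a b) HB) as [x [Hx Bx]].
    { destruct (Rtotal_order a b) as [?|[->|?]]; [|lra|].
      - rewrite Rmin_left, Rmax_right; lra.
      - rewrite Rmin_right, Rmax_left; lra. }
    exists x. split; [exact Bx|]. split; [exact Hx|].
    pose proof (Hclose x ltac:(lra)) as Kx. pose proof (Hclose a Ha) as Ka.
    pose proof (Hclose b Hb) as Kb. apply Rabs_def2 in Kx, Ka, Kb. lra.
  - intros x eps He. exists (rk x). intros n Hn. unfold Rdist, fn.
    destruct (excluded_middle_informative (C x \/ (rk x <= n)%nat)) as [_|Hx]; [|tauto].
    unfold Rminus. rewrite Rplus_opp_r, Rabs_R0. exact He.
Qed.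

(** * Dyadic decomposition *)

Lemma dyadic_lt (m : nat) (a b : Z) : IZR a / 2 ^ m < IZR b / 2 ^ m <-> (a < b)%Z.
Proof.
  pose proof (inv_pow2_pos m). unfold Rdiv. split; intros H'.
  - apply lt_IZR. apply Rmult_lt_reg_r with (1 := H), H'.
  - apply Rmult_lt_compat_r; [exact H|]. apply IZR_lt, H'.
Qed.

Lemma dyadic_refine (m m' : nat) (k : Z) :
  (m <= m')%nat -> IZR k / 2 ^ m = IZR (k * 2 ^ Z.of_nat (m' - m)) / 2 ^ m'.
Proof.
  intros H. rewrite mult_IZR, <- pow_IZR.
  replace (2 ^ m') with (2 ^ m * 2 ^ (m' - m)) by (rewrite <- pow_add; f_equal; lia).
  field. split; apply pow_nonzero; lra.
Qed.

(** The closed complement of a union of open dyadic intervals. Dyadic intervals are used because any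
    two of them are nested or disjoint; generations from n on keep them no longer than 2^-n. *)
Definition dyadic_exceptional (G : R -> R -> Prop) (n : nat) (x : R) : Prop :=
  forall m k, (n <= m)%nat -> IZR k / 2 ^ m < x < IZR (k + 1) / 2 ^ m ->
    ~ G (IZR k / 2 ^ m) (IZR (k + 1) / 2 ^ m).

(* The components of the complement are the maximal dyadic intervals satisfying G. *)
Lemma dyadic_exceptional_component (G : R -> R -> Prop) (n : nat) (x : R) :
  ~ dyadic_exceptional G n x ->
  exists l r, l < x < r /\ dyadic_exceptional G n l /\ dyadic_exceptional G n r /\
    (forall y, l < y < r -> ~ dyadic_exceptional G n y) /\ G l r /\ r - l <= / 2 ^ n.
Proof.
  intros Hx.
  destruct (least_nat (fun m => (n <= m)%nat /\ exists k,
    IZR k / 2 ^ m < x < IZR (k + 1) / 2 ^ m /\ G (IZR k / 2 ^ m) (IZR (k + 1) / 2 ^ m)))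
    as [m [[Hnm [k [Hk HG]]] Hmin]].
  { apply NNPP. intros Hn. apply Hx. intros m k Hm Hk HG. apply Hn.
    exists m. split; [exact Hm|]. exists k. split; assumption. }
  (* A coarser good interval around an end point would contain x as well, against minimality of m. A
     point of generation m is never interior to a dyadic interval of generation m or finer. *)
  assert (Hend : forall e, (e = k \/ e = k + 1)%Z -> dyadic_exceptional G n (IZR e / 2 ^ m)).
  { intros e He m' k' Hm' Hk' HG'. destruct (Nat.lt_ge_cases m' m) as [Hlt|Hge].
    - assert (Hx' : IZR k' / 2 ^ m' < x < IZR (k' + 1) / 2 ^ m').
      { rewrite !(dyadic_refine m' m) in * by lia.
        destruct Hk' as [E1 E2]. apply dyadic_lt in E1, E2.
        set (K := (k' * 2 ^ Z.of_nat (m - m'))%Z) in *.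
        set (L := ((k' + 1) * 2 ^ Z.of_nat (m - m'))%Z) in *.
        assert (K1 : IZR K / 2 ^ m <= IZR k / 2 ^ m)
          by (apply Rnot_lt_le; intros H; apply dyadic_lt in H; lia).
        assert (K2 : IZR (k + 1) / 2 ^ m <= IZR L / 2 ^ m)
          by (apply Rnot_lt_le; intros H; apply dyadic_lt in H; lia).
        lra. }
      specialize (Hmin m' (conj Hm' (ex_intro _ k' (conj Hx' HG')))). lia.
    - rewrite (dyadic_refine m m') in Hk' by exact Hge.
      destruct Hk' as [H1 H2]. apply dyadic_lt in H1, H2. lia. }
  exists (IZR k / 2 ^ m), (IZR (k + 1) / 2 ^ m).
  split; [exact Hk|]. split; [apply Hend; auto|]. split; [apply Hend; auto|].
  split; [|split; [exact HG|]].
  - intros y Hy H. exact (H m k Hnm Hy HG).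
  - rewrite plus_IZR. pose proof (inv_pow2_le n m Hnm). unfold Rdiv. lra.
Qed.

Lemma dyadic_exceptional_codense (G : R -> R -> Prop) (n : nat) :
  (forall u v, u < v -> exists c d, u <= c /\ c < d /\ d <= v /\
     forall c' d', c <= c' -> d' <= d -> G c' d') ->
  forall u v, u < v -> exists x, u < x < v /\ ~ dyadic_exceptional G n x.
Proof.
  intros H u v Huv. destruct (H u v Huv) as [c [d [H1 [H2 [H3 H4]]]]].
  destruct (inv_pow2_small ((d - c) / 2)) as [m0 Hm0]; [lra|].
  set (m := Nat.max m0 n). pose proof (inv_pow2_le m0 m ltac:(lia)).
  pose proof (inv_pow2_pos m).
  (* The dyadic interval after the one containing c lies inside (c, d), as 2/2^m < d - c; its
     midpoint is the witness. *)
  destruct (dyadic_left c m) as [k [Hk1 Hk2]]. unfold Rdiv in *.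
  exists ((IZR k + 3 / 2) * / 2 ^ m). split; [lra|].
  intros Hx. apply (Hx m (k + 1)%Z); [lia| |].
  - rewrite !plus_IZR. unfold Rdiv. lra.
  - apply H4; rewrite !plus_IZR; unfold Rdiv; lra.
Qed.

(** * Functions of the class frakS *)

(* f is within eps of v on C, and takes at most one value on each side of the band of
   radius eps around v: this is what S_J gives on an interval where f|C is almost constant. *)
Definition nearly_const (C : R -> Prop) (f : R -> R) (v eps c d : R) : Prop :=
  (forall x, C x -> c < x < d -> Rabs (f x - v) < eps) /\
  (forall a b, c < a < d -> c < b < d -> f a < f b -> f a < v + eps /\ v - eps < f b).

Lemma nearly_const_mono (C : R -> Prop) (f : R -> R) (v eps eps' c d c' d' : R) :
  c <= c' -> d' <= d -> eps <= eps' ->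
  nearly_const C f v eps c d -> nearly_const C f v eps' c' d'.
Proof.
  intros Hc Hd He [H1 H2]. split.
  - intros x Cx Hx. apply Rlt_le_trans with (2 := He), H1; [exact Cx|lra].
  - intros a b Ha Hb Hab. destruct (H2 a b); lra.
Qed.

Lemma frakS_nearly_const (C : R -> Prop) (f : R -> R) (eps u v : R) :
  residual C -> cont_on C f -> frakS f -> 0 < eps -> u < v ->
  exists w c d, u <= c /\ c < d /\ d <= v /\ nearly_const C f w eps c d.
Proof.
  intros HC Hc [_ HS] He Huv.
  destruct (residual_dense C u v HC Huv) as [c0 [Hc0 Cc0]].
  destruct (Hc c0 Cc0 (eps / 2)) as [del [Hd Hdel]]; [lra|].
  set (u' := Rmax u (c0 - del)). set (v' := Rmin v (c0 + del)).
  assert (u <= u') by apply Rmax_l. assert (c0 - del <= u') by apply Rmax_r.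
  assert (v' <= v) by apply Rmin_l. assert (v' <= c0 + del) by apply Rmin_r.
  assert (Huv' : u' < v') by (apply Rmax_lub_lt; apply Rmin_glb_lt; lra).
  destruct (HS C HC (eps / 2) ltac:(lra) u' v' Huv') as [x [c [d [Hx [Hcd HJ]]]]].
  pose proof (Rmax_l u' c). pose proof (Rmax_r u' c).
  pose proof (Rmin_l v' d). pose proof (Rmin_r v' d).
  exists (f c0), (Rmax u' c), (Rmin v' d). split; [lra|].
  split; [apply Rmax_lub_lt; apply Rmin_glb_lt; lra|]. split; [lra|].
  assert (HfC : forall y, C y -> u' < y < v' -> Rabs (f y - f c0) < eps / 2).
  { intros y Cy Hy. apply Hdel; [exact Cy|]. apply Rabs_def1; lra. }
  split.
  - intros y Cy Hy. apply Rlt_trans with (eps / 2); [|lra]. apply HfC; [exact Cy|lra].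
  - intros a b Ha Hb Hab.
    (* The point y of C has its value within eps/2 of f c0 and, up to eps/2, between f a and f b.
       This yields both inequalities. *)
    destruct (HJ a b ltac:(lra) ltac:(lra) Hab) as [y [Cy [Hy Hfy]]]. unfold Iab in Hy.
    assert (u' < Rmin a b) by (apply Rmin_glb_lt; lra).
    assert (Rmax a b < v') by (apply Rmax_lub_lt; lra).
    pose proof (HfC y Cy ltac:(lra)) as Hy'. apply Rabs_def2 in Hy'. lra.
Qed.

Lemma frakS_decomposition (f : R -> R) : frakS f ->
  exists (C : R -> Prop) (F : nat -> R -> Prop), residual C /\
    (forall x, ~ C x -> exists n, F n x) /\
    (forall m n x, (m <= n)%nat -> F m x -> F n x) /\
    (forall n u v, u < v -> exists x, u < x < v /\ ~ F n x) /\
    (forall n x, ~ F n x -> exists l r w, l < x < r /\ F n l /\ F n r /\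
       (forall y, l < y < r -> ~ F n y) /\ r - l <= / 2 ^ n /\
       nearly_const C f w (/ 2 ^ n) l r).
Proof.
  intros Hf. pose proof Hf as [Hb _].
  destruct (baire_property_generic_cont f Hb) as [C [HC Hc]].
  pose proof HC as [A [HA HCA]].
  (* Avoiding the first nowhere dense sets makes [F n] contain [A n], so that the complement of C is
     covered. Both requirements tighten with n, so the sets [F n] increase. *)
  set (G := fun n c d => (exists w, nearly_const C f w (/ 2 ^ n) c d) /\
    forall i, (i <= n)%nat -> forall x, c < x < d -> ~ A i x).
  exists C, (fun n => dyadic_exceptional (G n) n). split; [exact HC|].
  split; [|split; [|split]].
  - intros x Cx. destruct (HCA x Cx) as [n Ax]. exists n.
    intros m k _ Hk [_ HG]. exact (HG n (le_n n) x Hk Ax).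
  - intros m n x Hmn Hx m' k Hm' Hk [[w Hw] HG]. apply (Hx m' k ltac:(lia) Hk). split.
    + exists w. revert Hw. apply nearly_const_mono; try apply Rle_refl.
      apply inv_pow2_le, Hmn.
    + intros i Hi. apply HG. lia.
  - intros n. apply dyadic_exceptional_codense. intros u v Huv.
    destruct (frakS_nearly_const C f (/ 2 ^ n) u v HC Hc Hf (inv_pow2_pos n) Huv)
      as [w [c [d [H1 [H2 [H3 H4]]]]]].
    destruct (nowhere_dense_avoid_upto A n c d HA H2) as [c' [d' [K1 [K2 [K3 K4]]]]].
    exists c', d'. split; [lra|]. split; [lra|]. split; [lra|].
    intros c'' d'' Hc'' Hd''. split.
    + exists w. revert H4. apply nearly_const_mono; lra.
    + intros i Hi x Hx. apply K4; [exact Hi|lra].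
  - intros n x Hx.
    destruct (dyadic_exceptional_component (G n) n x Hx)
      as (l & r & H1 & H2 & H3 & H4 & [[w Hw] _] & H6).
    exists l, r, w. auto 6.
Qed.

(** * Oscillation *)

(** This is u sin u with u = 1/((x - l)(r - x)), which tends to infinity at both ends of (l, r).
    Hence every real value is taken arbitrarily close to each end. *)
Definition oscillation (l r x : R) : R :=
  / ((x - l) * (r - x)) * sin (/ ((x - l) * (r - x))).

(** From pi/2 + 2k pi to 3pi/2 + 2k pi the function u sin u runs from u to -u, and k exceeds both
    |U| and |t|. *)
Lemma id_sin_onto (U t : R) : exists u, U < u /\ u * sin u = t.
Proof.
  destruct (INR_unbounded (Rmax (Rabs U) (Rabs t))) as [k Hk].
  pose proof (Rmax_l (Rabs U) (Rabs t)). pose proof (Rmax_r (Rabs U) (Rabs t)).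
  pose proof (Rle_abs U). pose proof (Rle_abs t). pose proof (Rle_abs (- t)) as Ht.
  rewrite Rabs_Ropp in Ht.
  pose proof PI2_3_2. pose proof (pos_INR k).
  assert (Hp : INR k <= INR k * (2 * PI)) by nra.
  destruct (IVT (fun u => t - u * sin u) (PI / 2 + 2 * INR k * PI)
    (3 * (PI / 2) + 2 * INR k * PI)) as [u [Hu Hu']].
  - reg.
  - lra.
  - rewrite sin_period, sin_PI2. nra.
  - rewrite sin_period, sin_3PI2. nra.
  - exists u. split; nra.
Qed.

Lemma oscillation_continuous (l r x : R) : l < x < r -> continuity_pt (oscillation l r) x.
Proof.
  intros Hx. unfold oscillation.
  assert (Hi : continuity_pt (fun y => / ((y - l) * (r - y))) x).
  { apply (continuity_pt_inv (fun y => (y - l) * (r - y))); [reg|]. nra. }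
  apply (continuity_pt_mult (fun y => / ((y - l) * (r - y)))
          (fun y => sin (/ ((y - l) * (r - y))))); [exact Hi|].
  apply (continuity_pt_comp (fun y => / ((y - l) * (r - y))) sin); [exact Hi|].
  apply continuity_sin.
Qed.

(** On [z, r] the product (x - l)(r - x) falls to 0, so it takes the value 1/u for each large u;
    [id_sin_onto] supplies such a u with u sin u = t. *)
Lemma oscillation_onto_right (l r z t : R) : l < z < r ->
  exists x, z < x < r /\ oscillation l r x = t.
Proof.
  intros Hz. assert (Hp : 0 < (z - l) * (r - z)) by nra.
  destruct (id_sin_onto (/ ((z - l) * (r - z))) t) as [u [Hu Hut]].
  pose proof (Rinv_0_lt_compat _ Hp).
  assert (Hu0 : 0 < / u) by (apply Rinv_0_lt_compat; lra).
  assert (Hlt : / u < (z - l) * (r - z)).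
  { rewrite <- (Rinv_inv ((z - l) * (r - z))). apply Rinv_lt_contravar; [nra|exact Hu]. }
  destruct (IVT (fun x => / u - (x - l) * (r - x)) z r) as [x [Hx Hx']].
  - reg.
  - lra.
  - lra.
  - replace (r - r) with 0 by ring. lra.
  - exists x. split.
    + split.
      * destruct (Rle_lt_or_eq_dec _ _ (proj1 Hx)) as [?|<-]; [assumption|lra].
      * destruct (Rle_lt_or_eq_dec _ _ (proj2 Hx)) as [?| ->]; [assumption|].
        replace (r - r) with 0 in Hx' by ring. lra.
    + unfold oscillation. replace ((x - l) * (r - x)) with (/ u) by lra.
      rewrite Rinv_inv. exact Hut.
Qed.

(** Reflection in the midpoint of (l, r) leaves [oscillation] unchanged. *)
Lemma oscillation_onto_left (l r z t : R) : l < z < r ->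
  exists x, l < x < z /\ oscillation l r x = t.
Proof.
  intros Hz. destruct (oscillation_onto_right l r (l + r - z) t) as [x [Hx Ht]]; [lra|].
  exists (l + r - x). split; [lra|]. rewrite <- Ht. unfold oscillation.
  replace ((l + r - x - l) * (r - (l + r - x))) with ((x - l) * (r - x)) by ring.
  reflexivity.
Qed.

(** A homeomorphism of the line onto the band (v - e, v + e), so a squeezed oscillation still takes
    every value of the band near each end. *)
Definition squeeze (v e t : R) : R := v + e * (2 * atan t / PI).

Lemma squeeze_bound (v e t : R) : 0 < e -> Rabs (squeeze v e t - v) < e.
Proof.
  intros He. unfold squeeze. destruct (atan_bound t) as [H1 H2]. pose proof PI_RGT_0.
  assert (K1 : 2 * atan t / PI < 1).
  { apply Rmult_lt_reg_r with PI; [lra|]. field_simplify; lra. }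
  assert (K2 : - 1 < 2 * atan t / PI).
  { apply Rmult_lt_reg_r with PI; [lra|]. field_simplify; lra. }
  apply Rabs_def1; nra.
Qed.

Lemma squeeze_onto (v e y : R) : 0 < e -> Rabs (y - v) < e -> exists t, squeeze v e t = y.
Proof.
  intros He Hy. apply Rabs_def2 in Hy. pose proof PI_RGT_0.
  set (s := (y - v) / e).
  assert (Hs : y = v + e * s) by (unfold s; field; lra).
  exists (tan (s * (PI / 2))). unfold squeeze. rewrite atan_tan.
  - rewrite Hs. field. lra.
  - split; nra.
Qed.

Lemma squeeze_continuous (v e : R) : continuity (squeeze v e).
Proof.
  intros x. unfold squeeze.
  apply (continuity_pt_plus (fun _ => v) (fun t => e * (2 * atan t / PI))); [reg|].
  apply (continuity_pt_scal (fun t => 2 * atan t / PI)).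
  apply (continuity_pt_mult (fun t => 2 * atan t) (fun _ => / PI)); [|reg].
  apply (continuity_pt_scal atan).
  apply derivable_continuous_pt, derivable_pt_atan.
Qed.

Lemma continuity_pt_local (f g : R -> R) (l r x : R) :
  l < x < r -> (forall y, l < y < r -> f y = g y) ->
  continuity_pt g x -> continuity_pt f x.
Proof.
  intros Hx Hfg Hg. apply continuity_pt_iff. intros eps He.
  destruct (proj1 (continuity_pt_iff g x) Hg eps He) as [del [Hd H]].
  exists (Rmin del (Rmin (x - l) (r - x))). split.
  - repeat apply Rmin_glb_lt; lra.
  - pose proof (Rmin_l del (Rmin (x - l) (r - x))).
    pose proof (Rmin_r del (Rmin (x - l) (r - x))).
    pose proof (Rmin_l (x - l) (r - x)). pose proof (Rmin_r (x - l) (r - x)).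
    intros y Hy. rewrite !Hfg; [apply H; lra|lra|].
    apply Rabs_def2 in Hy. lra.
Qed.

(** * The approximating sequence *)

(* (lo n x, hi n x) is the component of x in the complement of F n; it has level lev n x
   at stage n, the least j such that it comes within 1/2^n of F j. *)
Record layering (f : R -> R) (C : R -> Prop) (F : nat -> R -> Prop)
    (lo hi mid : nat -> R -> R) (lev : nat -> R -> nat) : Prop := {
  ly_residual : residual C;
  ly_cover : forall x, ~ C x -> exists n, F n x;
  ly_mono : forall m n x, (m <= n)%nat -> F m x -> F n x;
  ly_codense : forall n u v, u < v -> exists x, u < x < v /\ ~ F n x;
  ly_in : forall n x, ~ F n x -> lo n x < x < hi n x;
  ly_lo : forall n x, ~ F n x -> F n (lo n x);
  ly_hi : forall n x, ~ F n x -> F n (hi n x);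
  ly_free : forall n x y, ~ F n x -> lo n x < y < hi n x -> ~ F n y;
  ly_short : forall n x, ~ F n x -> hi n x - lo n x <= / 2 ^ n;
  ly_const : forall n x, ~ F n x ->
    nearly_const C f (mid n x) (/ 2 ^ n) (lo n x) (hi n x);
  ly_same : forall n x y, ~ F n x -> lo n x < y < hi n x ->
    lo n y = lo n x /\ hi n y = hi n x /\ mid n y = mid n x /\ lev n y = lev n x;
  ly_near : forall n x, ~ F n x -> exists y q,
    lo n x < y < hi n x /\ F (lev n x) q /\ Rabs (y - q) < / 2 ^ n;
  ly_least : forall n x y q j, ~ F n x ->
    lo n x < y < hi n x -> F j q -> Rabs (y - q) < / 2 ^ n -> (lev n x <= j)%nat
}.

Lemma frakS_layering (f : R -> R) : frakS f ->
  exists C F lo hi mid lev, layering f C F lo hi mid lev.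
Proof.
  intros Hf. destruct (frakS_decomposition f Hf) as (C & F & HC & Hcov & Hmono & Hden & Hcomp).
  destruct (choice_fun (fun (q : nat * R) (r : R * R) => ~ F (fst q) (snd q) ->
    fst r < snd q < snd r /\ F (fst q) (fst r) /\ F (fst q) (snd r) /\
    (forall y, fst r < y < snd r -> ~ F (fst q) y) /\ snd r - fst r <= / 2 ^ fst q /\
    exists w, nearly_const C f w (/ 2 ^ fst q) (fst r) (snd r))) as [h Hh].
  { intros [n x]; simpl. destruct (classic (F n x)) as [Hx|Hx]; [exists (0, 0); tauto|].
    destruct (Hcomp n x Hx) as (l & r & w & H1 & H2 & H3 & H4 & H5 & H6).
    exists (l, r). simpl. intros _. repeat (split; [assumption|]). exists w. exact H6. }
  (* The central value is chosen from the end points rather than from x, so it is constant on each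
     component. *)
  destruct (choice_fun (fun (q : nat * (R * R)) w =>
    (exists w, nearly_const C f w (/ 2 ^ fst q) (fst (snd q)) (snd (snd q))) ->
    nearly_const C f w (/ 2 ^ fst q) (fst (snd q)) (snd (snd q)))) as [m Hm].
  { intros q. destruct (classic (exists w, nearly_const C f w (/ 2 ^ fst q)
      (fst (snd q)) (snd (snd q)))) as [[w Hw]|Hn]; [exists w; auto|exists 0; tauto]. }
  set (lo := fun n x => fst (h (n, x))). set (hi := fun n x => snd (h (n, x))).
  set (near := fun n x j => exists y q,
    lo n x < y < hi n x /\ F j q /\ Rabs (y - q) < / 2 ^ n).
  assert (HF : forall n x, ~ F n x -> lo n x < x < hi n x /\ F n (lo n x) /\ F n (hi n x) /\
    (forall y, lo n x < y < hi n x -> ~ F n y) /\ hi n x - lo n x <= / 2 ^ n /\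
    exists w, nearly_const C f w (/ 2 ^ n) (lo n x) (hi n x)) by (intros n x; apply (Hh (n, x))).
  destruct (choice_fun (fun (q : nat * R) j => ~ F (fst q) (snd q) ->
    near (fst q) (snd q) j /\ forall i, near (fst q) (snd q) i -> (j <= i)%nat)) as [lev Hlev].
  { intros [n x]; simpl. destruct (classic (F n x)) as [Hx|Hx]; [exists O; tauto|].
    destruct (least_nat (near n x)) as [j Hj]; [|exists j; auto].
    destruct (HF n x Hx) as (H1 & H2 & _ & _ & H5 & _).
    (* Some level exists because x is within 2^-n of the end point [lo n x] of its component. *)
    exists n, x, (lo n x). split; [exact H1|]. split; [exact H2|].
    apply Rabs_def1; lra. }
  assert (Hsame : forall n x y, ~ F n x -> lo n x < y < hi n x ->
    lo n y = lo n x /\ hi n y = hi n x).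
  { intros n x y Hx Hy. destruct (HF n x Hx) as (H1 & H2 & H3 & H4 & _).
    destruct (HF n y (H4 y Hy)) as (K1 & K2 & K3 & K4 & _).
    split; apply Rle_antisym; apply Rnot_lt_le; intros Hlt.
    - apply (H4 (lo n y)); [lra|exact K2].
    - apply (K4 (lo n x)); [lra|exact H2].
    - apply (K4 (hi n x)); [lra|exact H3].
    - apply (H4 (hi n y)); [lra|exact K3]. }
  exists C, F, lo, hi, (fun n x => m (n, (lo n x, hi n x))), (fun n x => lev (n, x)).
  split; try assumption.
  - intros n x Hx. apply (HF n x Hx).
  - intros n x Hx. apply (HF n x Hx).
  - intros n x Hx. apply (HF n x Hx).
  - intros n x y Hx. apply (HF n x Hx).
  - intros n x Hx. apply (HF n x Hx).
  - intros n x Hx. apply (Hm (n, (lo n x, hi n x))), (HF n x Hx).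
  - intros n x y Hx Hy. destruct (Hsame n x y Hx Hy) as [E1 E2].
    rewrite E1, E2. repeat (split; [reflexivity|]).
    assert (Hy' : ~ F n y) by (apply (HF n x Hx); exact Hy).
    (* Nearness refers to x only through the end points, so the least levels agree. *)
    destruct (Hlev (n, x) Hx) as [H1 H2]. destruct (Hlev (n, y) Hy') as [K1 K2].
    unfold near in H1, H2, K1, K2. simpl fst in *. simpl snd in *.
    rewrite E1, E2 in K1, K2. apply Nat.le_antisymm; auto.
  - intros n x Hx. apply (Hlev (n, x) Hx).
  - intros n x y q j Hx Hy HFq Hyq. apply (Hlev (n, x) Hx). exists y, q. auto.
Qed.

(** On level [S j] the band is taken from stage j, where x is still off [F j] because levels at
    stage n are at most n. Level 0 has no preceding stage, hence no band. *)
Definition approximant (f : R -> R) (F : nat -> R -> Prop) (lo hi mid : nat -> R -> R)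
    (lev : nat -> R -> nat) (n : nat) (x : R) : R :=
  if excluded_middle_informative (F n x) then f x
  else match lev n x with
       | O => oscillation (lo n x) (hi n x) x
       | S j => squeeze (mid j x) (4 * / 2 ^ j) (oscillation (lo n x) (hi n x) x)
       end.

Lemma approximant_on (f : R -> R) F lo hi mid lev n x :
  F n x -> approximant f F lo hi mid lev n x = f x.
Proof. intros Hx. unfold approximant. destruct (excluded_middle_informative _); tauto. Qed.

Lemma approximant_off (f : R -> R) F lo hi mid lev n x :
  ~ F n x -> approximant f F lo hi mid lev n x =
    match lev n x with
    | O => oscillation (lo n x) (hi n x) x
    | S j => squeeze (mid j x) (4 * / 2 ^ j) (oscillation (lo n x) (hi n x) x)
    end.
Proof. intros Hx. unfold approximant. destruct (excluded_middle_informative _); tauto. Qed.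

Lemma layering_lev_le f C F lo hi mid lev n x :
  layering f C F lo hi mid lev -> ~ F n x -> (lev n x <= n)%nat.
Proof.
  intros HL Hx. pose proof (ly_in _ _ _ _ _ _ _ HL n x Hx).
  pose proof (ly_short _ _ _ _ _ _ _ HL n x Hx).
  apply (ly_least _ _ _ _ _ _ _ HL n x x (lo n x) n Hx H).
  - apply (ly_lo _ _ _ _ _ _ _ HL n x Hx).
  - apply Rabs_def1; lra.
Qed.

Lemma layering_nested f C F lo hi mid lev m n x :
  layering f C F lo hi mid lev -> (m <= n)%nat -> ~ F n x ->
  ~ F m x /\ lo m x <= lo n x /\ hi n x <= hi m x.
Proof.
  intros HL Hmn Hx.
  assert (Hx' : ~ F m x) by (intros H; apply Hx, (ly_mono _ _ _ _ _ _ _ HL m n x Hmn H)).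
  pose proof (ly_in _ _ _ _ _ _ _ HL n x Hx). pose proof (ly_in _ _ _ _ _ _ _ HL m x Hx').
  split; [exact Hx'|]. split; apply Rnot_lt_le; intros Hlt.
  - apply (ly_free _ _ _ _ _ _ _ HL n x (lo m x) Hx); [lra|].
    apply (ly_mono _ _ _ _ _ _ _ HL m n _ Hmn), (ly_lo _ _ _ _ _ _ _ HL m x Hx').
  - apply (ly_free _ _ _ _ _ _ _ HL n x (hi m x) Hx); [lra|].
    apply (ly_mono _ _ _ _ _ _ _ HL m n _ Hmn), (ly_hi _ _ _ _ _ _ _ HL m x Hx').
Qed.

(** The bands are nested. A point of C in the smaller component shows that the two centres differ by
    less than 2^-j + 2^-i; for i < j the sum 5 * 2^-j + 2^-i is below 4 * 2^-i, so radius 4 leaves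
    enough room. *)
Lemma layering_band f C F lo hi mid lev i j x y :
  layering f C F lo hi mid lev -> (i <= j)%nat -> ~ F j x ->
  Rabs (y - mid j x) < 4 * / 2 ^ j -> Rabs (y - mid i x) < 4 * / 2 ^ i.
Proof.
  intros HL Hij Hx Hy. destruct (Nat.eq_dec i j) as [->|Hne]; [exact Hy|].
  destruct (layering_nested _ _ _ _ _ _ _ i j x HL Hij Hx) as (Hxi & H1 & H2).
  pose proof (ly_in _ _ _ _ _ _ _ HL j x Hx).
  destruct (residual_dense C (lo j x) (hi j x)) as [c [Hc Cc]];
    [apply (ly_residual _ _ _ _ _ _ _ HL)|lra|].
  pose proof (proj1 (ly_const _ _ _ _ _ _ _ HL j x Hx) c Cc Hc) as K1.
  pose proof (proj1 (ly_const _ _ _ _ _ _ _ HL i x Hxi) c Cc ltac:(lra)) as K2.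
  pose proof (inv_pow2_le (S i) j ltac:(lia)) as Hp. rewrite inv_pow2_S in Hp.
  pose proof (inv_pow2_pos i).
  apply Rabs_def2 in Hy, K1, K2. apply Rabs_def1; lra.
Qed.

Lemma approximant_in_band f C F lo hi mid lev n x i :
  layering f C F lo hi mid lev -> ~ F n x -> (S i <= lev n x)%nat ->
  Rabs (approximant f F lo hi mid lev n x - mid i x) < 4 * / 2 ^ i.
Proof.
  intros HL Hx Hi. rewrite approximant_off by exact Hx.
  pose proof (layering_lev_le _ _ _ _ _ _ _ n x HL Hx) as Hn.
  destruct (lev n x) as [|j]; [lia|].
  destruct (layering_nested _ _ _ _ _ _ _ j n x HL ltac:(lia) Hx) as (Hxj & _).
  apply (layering_band _ _ _ _ _ _ _ i j x _ HL ltac:(lia) Hxj).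
  apply squeeze_bound. pose proof (inv_pow2_pos j). lra.
Qed.

(** All parameters are frozen at x: a component at stage n lies inside one at stage j, so even
    [mid j] is constant on it. *)
Lemma approximant_component f C F lo hi mid lev n x y :
  layering f C F lo hi mid lev -> ~ F n x -> lo n x < y < hi n x ->
  approximant f F lo hi mid lev n y =
    match lev n x with
    | O => oscillation (lo n x) (hi n x) y
    | S j => squeeze (mid j x) (4 * / 2 ^ j) (oscillation (lo n x) (hi n x) y)
    end.
Proof.
  intros HL Hx Hy.
  rewrite approximant_off by (apply (ly_free _ _ _ _ _ _ _ HL n x y Hx Hy)).
  destruct (ly_same _ _ _ _ _ _ _ HL n x y Hx Hy) as (-> & -> & _ & ->).
  pose proof (layering_lev_le _ _ _ _ _ _ _ n x HL Hx) as Hn.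
  destruct (lev n x) as [|j]; [reflexivity|].
  destruct (layering_nested _ _ _ _ _ _ _ j n x HL ltac:(lia) Hx) as (Hxj & H1 & H2).
  destruct (ly_same _ _ _ _ _ _ _ HL j x y Hxj) as (_ & _ & -> & _); [lra|reflexivity].
Qed.

Lemma approximant_continuous f C F lo hi mid lev n x :
  layering f C F lo hi mid lev -> ~ F n x ->
  continuity_pt (approximant f F lo hi mid lev n) x.
Proof.
  intros HL Hx. pose proof (ly_in _ _ _ _ _ _ _ HL n x Hx) as Hin.
  apply continuity_pt_local with (l := lo n x) (r := hi n x) (1 := Hin)
    (2 := fun y Hy => approximant_component _ _ _ _ _ _ _ n x y HL Hx Hy).
  destruct (lev n x) as [|j]; [apply oscillation_continuous, Hin|].
  apply (continuity_pt_comp (oscillation (lo n x) (hi n x))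
           (squeeze (mid j x) (4 * / 2 ^ j))); [apply oscillation_continuous, Hin|].
  apply squeeze_continuous.
Qed.

(** A point q of [F n] is outside the component of z, so the end of that component on the side of q
    lies in [a, b]. Between z and this end the oscillation reaches every value of the band, or every
    real number on level 0. *)
Lemma approximant_onto f C F lo hi mid lev n z a b q s :
  layering f C F lo hi mid lev -> ~ F n z -> a < z < b -> F n q -> a <= q <= b ->
  (forall i, lev n z = S i -> Rabs (s - mid i z) < 4 * / 2 ^ i) ->
  exists x, a < x < b /\ ~ F n x /\ approximant f F lo hi mid lev n x = s.
Proof.
  intros HL Hz Hzab Hq Hqab Hs. pose proof (ly_in _ _ _ _ _ _ _ HL n z Hz) as Hin.
  assert (Ht : exists t, forall x, lo n z < x < hi n z ->
    oscillation (lo n z) (hi n z) x = t -> approximant f F lo hi mid lev n x = s).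
  { destruct (lev n z) as [|i] eqn:El.
    - exists s. intros x Hx Hox.
      rewrite (approximant_component _ _ _ _ _ _ _ n z x HL Hz Hx), El. exact Hox.
    - destruct (squeeze_onto (mid i z) (4 * / 2 ^ i) s) as [t Ht].
      + pose proof (inv_pow2_pos i). lra.
      + apply Hs. reflexivity.
      + exists t. intros x Hx Hox.
        rewrite (approximant_component _ _ _ _ _ _ _ n z x HL Hz Hx), El, Hox. exact Ht. }
  destruct Ht as [t Ht].
  assert (Hout : q <= lo n z \/ hi n z <= q).
  { destruct (Rle_or_lt q (lo n z)) as [?|?]; [left; assumption|right].
    apply Rnot_lt_le. intros H'. apply (ly_free _ _ _ _ _ _ _ HL n z q Hz); [lra|exact Hq]. }
  destruct Hout.
  - destruct (oscillation_onto_left (lo n z) (hi n z) z t Hin) as [x [Hx Hox]].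
    exists x. split; [lra|]. split; [apply (ly_free _ _ _ _ _ _ _ HL n z x Hz); lra|].
    apply Ht; [lra|exact Hox].
  - destruct (oscillation_onto_right (lo n z) (hi n z) z t Hin) as [x [Hx Hox]].
    exists x. split; [lra|]. split; [apply (ly_free _ _ _ _ _ _ _ HL n z x Hz); lra|].
    apply Ht; [lra|exact Hox].
Qed.

Lemma intermediate_value (f : R -> R) (a b s : R) :
  a < b -> (forall x, a <= x <= b -> continuity_pt f x) ->
  Rmin (f a) (f b) < s < Rmax (f a) (f b) -> exists x, a < x < b /\ f x = s.
Proof.
  intros Hab Hc Hs.
  assert (H : exists x, a <= x <= b /\ f x = s).
  { destruct (Rle_or_lt (f a) (f b)) as [Hle|Hlt].
    - rewrite Rmin_left, Rmax_right in Hs by lra.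
      destruct (Ranalysis5.IVT_interv (fun x => f x - s) a b) as [x [Hx Hx']]; try lra.
      + intros x Hx. apply (continuity_pt_minus f (fun _ => s)); [apply Hc, Hx|reg].
      + exists x. split; [exact Hx|lra].
    - rewrite Rmin_right, Rmax_left in Hs by lra.
      destruct (Ranalysis5.IVT_interv (fun x => s - f x) a b) as [x [Hx Hx']]; try lra.
      + intros x Hx. apply (continuity_pt_minus (fun _ => s) f); [reg|apply Hc, Hx].
      + exists x. split; [exact Hx|lra]. }
  destruct H as [x [Hx Hx']]. exists x. split; [|exact Hx'].
  assert (Hab' : f a <> s /\ f b <> s)
    by (unfold Rmin, Rmax in Hs; destruct (Rle_dec (f a) (f b)); lra).
  assert (x <> a) by (intros ->; tauto). assert (x <> b) by (intros ->; tauto). lra.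
Qed.

(** If q were in [F i], codensity would give a point of (a, b) off [F n] and within 2^-n of q, whose
    component then has level at most i. *)
Lemma layering_min_level f C F lo hi mid lev n a b i q :
  layering f C F lo hi mid lev -> a < b ->
  (forall x, a < x < b -> ~ F n x -> (S i <= lev n x)%nat) -> a <= q <= b -> ~ F i q.
Proof.
  intros HL Hab Hmin Hq HFq. pose proof (inv_pow2_pos n).
  pose proof (Rmax_l a (q - / 2 ^ n)). pose proof (Rmax_r a (q - / 2 ^ n)).
  pose proof (Rmin_l b (q + / 2 ^ n)). pose proof (Rmin_r b (q + / 2 ^ n)).
  destruct (ly_codense _ _ _ _ _ _ _ HL n (Rmax a (q - / 2 ^ n)) (Rmin b (q + / 2 ^ n)))
    as [x [Hx HFx]]; [apply Rmax_lub_lt; apply Rmin_glb_lt; lra|].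
  specialize (Hmin x ltac:(lra) HFx).
  pose proof (ly_least _ _ _ _ _ _ _ HL n x x q i HFx (ly_in _ _ _ _ _ _ _ HL n x HFx) HFq
    ltac:(apply Rabs_def1; lra)). lia.
Qed.

Lemma approximant_Swiatkowski f C F lo hi mid lev n :
  layering f C F lo hi mid lev -> Swiatkowski (approximant f F lo hi mid lev n).
Proof.
  intros HL a b Hab Hne. set (g := approximant f F lo hi mid lev n) in *.
  assert (Hmm : Rmin (g a) (g b) < Rmax (g a) (g b)).
  { unfold Rmin, Rmax. destruct (Rle_dec (g a) (g b)); lra. }
  destruct (classic (exists q, a <= q <= b /\ F n q)) as [[q [Hq HFq]]|Hno].
  (* When [a, b] misses [F n], the function is continuous there and the intermediate value theorem
     suffices. *)
  2:{ assert (Hfree : forall x, a <= x <= b -> ~ F n x)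
        by (intros x Hx HFx; apply Hno; exists x; auto).
      destruct (intermediate_value g a b ((Rmin (g a) (g b) + Rmax (g a) (g b)) / 2) Hab)
        as [x [Hx Hgx]].
      - intros x Hx. apply (approximant_continuous _ C); [exact HL|apply Hfree, Hx].
      - lra.
      - exists x. split; [exact Hx|]. split.
        + apply (approximant_continuous _ C); [exact HL|apply Hfree; lra].
        + rewrite Hgx. lra. }
  destruct (least_nat (fun j => exists z, a < z < b /\ ~ F n z /\ lev n z = j))
    as [j [[z [Hz [HFz Hlz]]] Hmin]].
  { destruct (ly_codense _ _ _ _ _ _ _ HL n a b Hab) as [z [Hz HFz]].
    exists (lev n z), z. auto. }
  (* Minimality extends to the end points a and b: a component containing one of them also meets (a,
     b), with the same level. *)
  assert (Hmin' : forall x, a <= x <= b -> ~ F n x -> (j <= lev n x)%nat).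
  { intros x Hx HFx. pose proof (ly_in _ _ _ _ _ _ _ HL n x HFx).
    pose proof (Rmax_l a (lo n x)). pose proof (Rmax_r a (lo n x)).
    pose proof (Rmin_l b (hi n x)). pose proof (Rmin_r b (hi n x)).
    set (y := (Rmax a (lo n x) + Rmin b (hi n x)) / 2).
    assert (Rmax a (lo n x) < Rmin b (hi n x))
      by (apply Rmax_lub_lt; apply Rmin_glb_lt; lra).
    assert (Hy : lo n x < y < hi n x) by (unfold y; lra).
    destruct (ly_same _ _ _ _ _ _ _ HL n x y HFx Hy) as (_ & _ & _ & <-).
    apply Hmin. exists y. split; [unfold y; lra|]. split; [|reflexivity].
    apply (ly_free _ _ _ _ _ _ _ HL n x y HFx Hy). }
  assert (Hs : exists s, Rmin (g a) (g b) < s < Rmax (g a) (g b) /\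
    forall i, lev n z = S i -> Rabs (s - mid i z) < 4 * / 2 ^ i).
  { destruct j as [|i].
    - exists ((Rmin (g a) (g b) + Rmax (g a) (g b)) / 2). split; [lra|].
      intros i Hi. rewrite Hlz in Hi. discriminate.
    (* Now [a, b] misses [F i], so it lies in a single component at stage i and one central value
       serves all its points. *)
    - assert (Hav : forall x, a <= x <= b -> ~ F i x).
      { intros x Hx. apply (layering_min_level _ _ _ _ _ _ _ n a b i x HL Hab); [|exact Hx].
        intros y Hy. apply Hmin'. lra. }
      pose proof (Hav z ltac:(lra)) as Hzi.
      pose proof (ly_in _ _ _ _ _ _ _ HL i z Hzi) as Hzin.
      assert (Hlo : lo i z < a).
      { apply Rnot_le_lt. intros H. apply (Hav (lo i z)); [lra|].
        apply (ly_lo _ _ _ _ _ _ _ HL i z Hzi). }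
      assert (Hhi : b < hi i z).
      { apply Rnot_le_lt. intros H. apply (Hav (hi i z)); [lra|].
        apply (ly_hi _ _ _ _ _ _ _ HL i z Hzi). }
      pose proof (inv_pow2_pos i) as Hp.
      assert (Hband : forall x, a <= x <= b -> ~ F n x ->
        Rabs (g x - mid i z) < 4 * / 2 ^ i).
      { intros x Hx HFx.
        destruct (ly_same _ _ _ _ _ _ _ HL i z x Hzi) as (_ & _ & <- & _); [lra|].
        apply (approximant_in_band _ C); [exact HL|exact HFx|apply Hmin'; assumption]. }
      (* Points off [F n] have values in the band; for two points of [F n] the values are those of f
         and near constancy applies. *)
      assert (Hpair : forall x y, a <= x <= b -> a <= y <= b -> g x < g y ->
        g x < mid i z + 4 * / 2 ^ i /\ mid i z - 4 * / 2 ^ i < g y).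
      { intros x y Hx Hy Hxy.
        destruct (classic (F n x)) as [Fx|Fx]; destruct (classic (F n y)) as [Fy|Fy].
        - assert (Ex : g x = f x) by (apply approximant_on, Fx).
          assert (Ey : g y = f y) by (apply approximant_on, Fy).
          destruct (proj2 (ly_const _ _ _ _ _ _ _ HL i z Hzi) x y); lra.
        - pose proof (Hband y Hy Fy) as K. apply Rabs_def2 in K. lra.
        - pose proof (Hband x Hx Fx) as K. apply Rabs_def2 in K. lra.
        - pose proof (Hband y Hy Fy) as K. pose proof (Hband x Hx Fx) as K'.
          apply Rabs_def2 in K, K'. lra. }
      assert (Hmm' : Rmin (g a) (g b) < mid i z + 4 * / 2 ^ i /\
                     mid i z - 4 * / 2 ^ i < Rmax (g a) (g b)).
      { destruct (Rle_or_lt (g a) (g b)) as [Hle|Hlt].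
        - rewrite Rmin_left, Rmax_right by lra. apply Hpair; lra.
        - rewrite Rmin_right, Rmax_left by lra. apply Hpair; lra. }
      set (m := Rmin (g a) (g b)) in *. set (M := Rmax (g a) (g b)) in *.
      pose proof (Rmax_l m (mid i z - 4 * / 2 ^ i)). pose proof (Rmax_r m (mid i z - 4 * / 2 ^ i)).
      pose proof (Rmin_l M (mid i z + 4 * / 2 ^ i)). pose proof (Rmin_r M (mid i z + 4 * / 2 ^ i)).
      assert (Rmax m (mid i z - 4 * / 2 ^ i) < Rmin M (mid i z + 4 * / 2 ^ i))
        by (apply Rmax_lub_lt; apply Rmin_glb_lt; lra).
      (* The midpoint of the overlap of the band with the interval between g a and g b. *)
      exists ((Rmax m (mid i z - 4 * / 2 ^ i) + Rmin M (mid i z + 4 * / 2 ^ i)) / 2).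
      split; [lra|]. intros i' Hi'. rewrite Hlz in Hi'. injection Hi' as <-.
      apply Rabs_def1; lra. }
  destruct Hs as [s [Hs1 Hs2]].
  destruct (approximant_onto _ _ _ _ _ _ _ n z a b q s HL HFz Hz HFq Hq Hs2)
    as [x [Hx [HFx Hgx]]].
  exists x. split; [exact Hx|]. split.
  - apply (approximant_continuous _ C); assumption.
  - change (g x = s) in Hgx. rewrite Hgx. exact Hs1.
Qed.

Lemma approximant_cv f C F lo hi mid lev x :
  layering f C F lo hi mid lev ->
  Un_cv (fun n => approximant f F lo hi mid lev n x) (f x).
Proof.
  intros HL eps He. destruct (classic (exists n, F n x)) as [[N HN]|Hno].
  { exists N. intros n Hn. unfold Rdist.
    rewrite approximant_on by (apply (ly_mono _ _ _ _ _ _ _ HL N n x Hn HN)).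
    unfold Rminus. rewrite Rplus_opp_r, Rabs_R0. exact He. }
  assert (HF : forall n, ~ F n x) by (intros n Hn; apply Hno; exists n; exact Hn).
  assert (Cx : C x).
  { apply NNPP. intros Hx. destruct (ly_cover _ _ _ _ _ _ _ HL x Hx) as [n Hn].
    exact (HF n Hn). }
  (* Four parts for the radius of the band, one for the distance from f x to its centre. *)
  destruct (inv_pow2_small (eps / 5)) as [j Hj]; [lra|].
  pose proof (ly_in _ _ _ _ _ _ _ HL j x (HF j)) as Hin.
  set (del := Rmin (x - lo j x) (hi j x - x)).
  assert (Hd : 0 < del) by (apply Rmin_glb_lt; lra).
  assert (del <= x - lo j x) by apply Rmin_l. assert (del <= hi j x - x) by apply Rmin_r.
  destruct (inv_pow2_small (del / 2)) as [N HN]; [lra|].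
  exists N. intros n Hn. unfold Rdist.
  pose proof (inv_pow2_le N n Hn) as Hp.
  (* Otherwise some q in [F j] is within 2^-n of the component of x, hence within 2 * 2^-n < del of
     x, and so lies in a component of the complement of [F j]. *)
  assert (Hlev : (S j <= lev n x)%nat).
  { apply Nat.nle_gt. intros Hle.
    destruct (ly_near _ _ _ _ _ _ _ HL n x (HF n)) as [y [q [Hy [Hq Hyq]]]].
    pose proof (ly_in _ _ _ _ _ _ _ HL n x (HF n)).
    pose proof (ly_short _ _ _ _ _ _ _ HL n x (HF n)).
    apply Rabs_def2 in Hyq.
    apply (ly_free _ _ _ _ _ _ _ HL j x q (HF j)); [lra|].
    apply (ly_mono _ _ _ _ _ _ _ HL _ _ _ Hle Hq). }
  pose proof (approximant_in_band _ _ _ _ _ _ _ n x j HL (HF n) Hlev) as K1.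
  pose proof (proj1 (ly_const _ _ _ _ _ _ _ HL j x (HF j)) x Cx Hin) as K2.
  apply Rabs_def2 in K1, K2. apply Rabs_def1; lra.
Qed.

Lemma frakS_LIM_Swiatkowski (f : R -> R) : frakS f -> LIM Swiatkowski f.
Proof.
  intros Hf. destruct (frakS_layering f Hf) as (C & F & lo & hi & mid & lev & HL).
  exists (approximant f F lo hi mid lev). split.
  - intros n. apply (approximant_Swiatkowski _ _ _ _ _ _ _ n HL).
  - intros x. apply (approximant_cv _ _ _ _ _ _ _ x HL).
Qed.

(** * The Baire hierarchy *)

Lemma BaireW_inv (F : fclass) (T : Type) (lt : T -> T -> Prop) (x : T) (g : R -> R) :
  BaireW F lt x g -> ((forall y, ~ lt y x) /\ F g) \/
    LIM (fun h => exists y, lt y x /\ BaireW F lt y h) g.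
Proof. intros H. destruct H; [left|right; exists fn]; auto. Qed.

Lemma Un_cv_const (c : R) : Un_cv (fun _ => c) c.
Proof.
  intros eps He. exists O. intros n _. unfold Rdist, Rminus.
  rewrite Rplus_opp_r, Rabs_R0. exact He.
Qed.

(** Constant sequences carry F up to every rank. *)
Lemma BaireW_base (F : fclass) (T : Type) (lt : T -> T -> Prop) (x : T) (g : R -> R) :
  well_founded lt -> F g -> BaireW F lt x g.
Proof.
  intros Hwf Hg. induction x as [x IH] using (well_founded_induction Hwf).
  destruct (classic (exists y, lt y x)) as [[y Hy]|Hn].
  - apply BaireW_lim with (fun _ => g); [|intros t; apply Un_cv_const].
    intros _. exists y. split; [exact Hy|apply IH, Hy].
  - apply BaireW_zero; [|exact Hg]. intros y Hy. apply Hn. exists y. exact Hy.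
Qed.

Lemma BaireW_LIM (F : fclass) (T : Type) (lt : T -> T -> Prop) (y x : T) (g : R -> R) :
  well_founded lt -> lt y x -> LIM F g -> BaireW F lt x g.
Proof.
  intros Hwf Hyx [fn [H1 H2]]. apply BaireW_lim with fn; [|exact H2].
  intros n. exists y. split; [exact Hyx|apply BaireW_base; auto].
Qed.

Lemma BaireW_baire_property (T : Type) (lt : T -> T -> Prop) (x : T) (g : R -> R) :
  well_founded lt -> BaireW Swiatkowski lt x g -> baire_property g.
Proof.
  intros Hwf. revert g. induction x as [x IH] using (well_founded_induction Hwf).
  intros g Hg. destruct (BaireW_inv _ _ _ _ _ Hg) as [[_ HS]|HL].
  - apply Swiatkowski_baire_property, HS.
  - revert HL. apply baire_property_limit. intros h [y [Hy Hh]]. exact (IH y Hy h Hh).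
Qed.

(** The larger of two predecessors has a predecessor itself, so its class contains all limits of
    Świątkowski functions, that is [frakS]; one more limit gives every function with the Baire
    property. *)
Lemma BaireW_rank_ge2 (T : Type) (lt : T -> T -> Prop) (x : T) :
  well_founded lt -> (forall y z, lt y z \/ y = z \/ lt z y) -> rank_ge2 lt x ->
  same_class (BaireW Swiatkowski lt x) baire_property.
Proof.
  intros Hwf Htot [y1 [y2 [H1 [H2 Hne]]]] g. split; [apply BaireW_baire_property, Hwf|].
  intros Hg. destruct (baire_property_LIM_frakS g Hg) as [fn [Hfn Hcv]].
  apply BaireW_lim with fn; [|exact Hcv]. intros n.
  pose proof (frakS_LIM_Swiatkowski _ (Hfn n)) as Hn.
  destruct (Htot y1 y2) as [Hlt|[Heq|Hlt]]; [|contradiction|].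
  - exists y2. split; [exact H2|]. apply BaireW_LIM with y1; assumption.
  - exists y1. split; [exact H1|]. apply BaireW_LIM with y2; assumption.
Qed.

Lemma BaireW_nat_0 (F : fclass) (g : R -> R) : BaireW F Nat.lt 0%nat g <-> F g.
Proof.
  split; [|apply BaireW_base, Nat.lt_wf_0].
  intros H. destruct (BaireW_inv _ _ _ _ _ H) as [[_ HF]|[fn [Hfn _]]]; [exact HF|].
  destruct (Hfn O) as [y [Hy _]]. inversion Hy.
Qed.

Lemma BaireW_nat_1 (F : fclass) (g : R -> R) : BaireW F Nat.lt 1%nat g <-> LIM F g.
Proof.
  split.
  - intros H. destruct (BaireW_inv _ _ _ _ _ H) as [[H0 _]|[fn [Hfn Hcv]]].
    + exfalso. apply (H0 O), Nat.lt_0_1.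
    + exists fn. split; [|exact Hcv]. intros n. destruct (Hfn n) as [y [Hy Hb]].
      assert (y = O) by (apply Nat.lt_1_r, Hy). subst y. apply BaireW_nat_0, Hb.
  - apply BaireW_LIM with O; [apply Nat.lt_wf_0|apply Nat.lt_0_1].
Qed.

(** * Strictness of the first two steps of the hierarchy *)

Lemma not_Swiatkowski_LIM : exists g, LIM Swiatkowski g /\ ~ Swiatkowski g.
Proof.
  (* The indicator of {0} takes no value strictly between 0 and 1. It is in [frakS] because g a < g
     b forces the values 0 and 1, and every value of g lies in [0, 1]. *)
  set (g := fun x => if Req_dec_T x 0 then 1 else 0).
  assert (Hg : forall x, x <> 0 -> g x = 0) by (intros x Hx; unfold g; destruct (Req_dec_T x 0); tauto).
  assert (Hg0 : g 0 = 1) by (unfold g; destruct (Req_dec_T 0 0); tauto).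
  assert (Hg01 : forall x, 0 <= g x <= 1)
    by (intros x; unfold g; destruct (Req_dec_T x 0); lra).
  exists g. split.
  - apply frakS_LIM_Swiatkowski. split.
    + apply generic_cont_baire_property. exists (fun x => x <> 0). split.
      * apply nowhere_dense_meager, nowhere_dense_intro. intros u v Huv.
        destruct (Rle_or_lt 0 u) as [H|H].
        -- exists u, v. repeat split; try lra. intros x Hx. lra.
        -- destruct (Rle_or_lt v 0) as [H'|H'].
           ++ exists u, v. repeat split; try lra. intros x Hx. lra.
           ++ exists 0, v. repeat split; try lra. intros x Hx. lra.
      * intros x Hx eps He. exists 1. split; [lra|]. intros y Hy _. rewrite !Hg by assumption.
        unfold Rminus. rewrite Rplus_opp_r, Rabs_R0. exact He.
    + intros A HA eps He u v Huv. exists ((u + v) / 2), u, v. split; [lra|]. split; [lra|].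
      intros a b Ha Hb Hab.
      destruct (residual_dense A (Rmin a b) (Rmax a b) HA) as [x [Hx Ax]].
      { destruct (Rtotal_order a b) as [?|[->|?]]; [|lra|].
        - rewrite Rmin_left, Rmax_right; lra.
        - rewrite Rmin_right, Rmax_left; lra. }
      exists x. split; [exact Ax|]. split; [exact Hx|].
      assert (a <> 0) by (intros ->; pose proof (Hg01 b); lra).
      rewrite (Hg a) in * by assumption. assert (g b = 1).
      { destruct (Req_dec b 0) as [->|Hb0]; [exact Hg0|]. rewrite (Hg b Hb0) in Hab. lra. }
      pose proof (Hg01 x). lra.
  - intros HS. destruct (HS (-1) 0 ltac:(lra)) as [x [Hx [_ Hgx]]].
    + rewrite Hg0, (Hg (-1)); lra.
    + rewrite (Hg x), (Hg (-1)), Hg0 in Hgx by lra. rewrite Rmin_left in Hgx; lra.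
Qed.

(** The function is the identity on the dyadic rationals and 0 elsewhere, so it vanishes on a
    residual set. Between dyadic a < b in (10, 11), a point of that set has value 0, far below a -
    1. *)
Lemma not_frakS_baire_property : exists g, baire_property g /\ ~ frakS g.
Proof.
  set (D := fun x => exists m k, x = IZR k / 2 ^ m).
  set (g := fun x => if excluded_middle_informative (D x) then x else 0).
  assert (HgD : forall x, D x -> g x = x)
    by (intros x Hx; unfold g; destruct (excluded_middle_informative (D x)); tauto).
  assert (Hg0 : forall x, ~ D x -> g x = 0)
    by (intros x Hx; unfold g; destruct (excluded_middle_informative (D x)); tauto).
  assert (HC : residual (fun x => ~ D x)).
  { apply meager_subset with D; [|intros x Hx; apply NNPP, Hx].
    apply meager_union; intros m. apply meager_union_Z; intros k.
    apply nowhere_dense_meager, nowhere_dense_intro. intros u v Huv.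
    set (p := IZR k / 2 ^ m). destruct (Rle_or_lt p u) as [H|H].
    - exists u, v. repeat split; try lra. intros x Hx. lra.
    - exists u, (Rmin p v). pose proof (Rmin_l p v). pose proof (Rmin_r p v).
      repeat split; try lra; [apply Rmin_glb_lt; lra|]. intros x Hx. lra. }
  assert (Hdense : forall c d, c < d -> exists x, c < x < d /\ D x).
  { intros c d Hcd. destruct (inv_pow2_small (d - c)) as [m Hm]; [lra|].
    destruct (dyadic_left c m) as [k [H1 H2]].
    exists (IZR (k + 1) / 2 ^ m). split; [|exists m, (k + 1)%Z; reflexivity].
    rewrite plus_IZR. unfold Rdiv in *. lra. }
  exists g. split.
  - apply generic_cont_baire_property. exists (fun x => ~ D x). split; [exact HC|].
    intros x Hx eps He. exists 1. split; [lra|]. intros y Hy _. rewrite !Hg0 by assumption.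
    unfold Rminus. rewrite Rplus_opp_r, Rabs_R0. exact He.
  - intros [_ HS].
    destruct (HS _ HC 1 ltac:(lra) 10 11 ltac:(lra)) as [x [c [d [Hx [Hcd HJ]]]]].
    pose proof (Rmin_l d 11). pose proof (Rmin_r d 11).
    assert (x < Rmin d 11) by (apply Rmin_glb_lt; lra).
    destruct (Hdense x (Rmin d 11)) as [a [Ha Da]]; [lra|].
    destruct (Hdense a (Rmin d 11)) as [b [Hb Db]]; [lra|].
    destruct (HJ a b ltac:(lra) ltac:(lra)) as [y [Hy [_ Hgy]]].
    + rewrite !HgD by assumption. lra.
    + rewrite !HgD in Hgy by assumption. rewrite Hg0 in Hgy by exact Hy. lra.
Qed.

Theorem mainTheorem9 :
  (* (i) B_1(S) = frakS *)
  same_class (BaireW Swiatkowski Nat.lt 1%nat) frakS /\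
  (* (ii) B_alpha(S) = Baire property class for every 1 < alpha < omega_1 *)
  (forall (T : Type) (lt : T -> T -> Prop), countable_wellorder T lt ->
     forall x : T, rank_ge2 lt x ->
       same_class (BaireW Swiatkowski lt x) baire_property) /\
  (* Baire order of S is 2: B_0 <> B_1, B_1 <> B_2, B_2 = B_3 *)
  (~ same_class (BaireW Swiatkowski Nat.lt 0%nat) (BaireW Swiatkowski Nat.lt 1%nat) /\
   ~ same_class (BaireW Swiatkowski Nat.lt 1%nat) (BaireW Swiatkowski Nat.lt 2%nat) /\
   same_class (BaireW Swiatkowski Nat.lt 2%nat) (BaireW Swiatkowski Nat.lt 3%nat)).
Proof.
  assert (H1 : same_class (BaireW Swiatkowski Nat.lt 1%nat) frakS).
  { intros g. rewrite BaireW_nat_1.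
    split; [apply LIM_Swiatkowski_frakS|apply frakS_LIM_Swiatkowski]. }
  assert (H2 : forall n, (2 <= n)%nat ->
    same_class (BaireW Swiatkowski Nat.lt n) baire_property).
  { intros n Hn. apply BaireW_rank_ge2; [exact Nat.lt_wf_0|exact Nat.lt_trichotomy|].
    exists 0%nat, 1%nat. unfold Nat.lt. repeat split; lia. }
  split; [exact H1|]. split.
  { intros T lt [Hwf [_ [Htot _]]] x Hx. apply BaireW_rank_ge2; assumption. }
  split; [|split].
  - intros H. destruct not_Swiatkowski_LIM as [g [Hg HnS]].
    apply HnS, BaireW_nat_0, H, BaireW_nat_1, Hg.
  - intros H. destruct not_frakS_baire_property as [g [Hg HnS]].
    apply HnS, H1, H, (H2 2%nat (le_n 2)), Hg.
  - intros g. rewrite (H2 2%nat (le_n 2) g), (H2 3%nat ltac:(lia) g). reflexivity.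
Qed.
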